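(* Let $d$ and $r$ be integers with $d\ge 6$ and $3\le r\le d-3$ such that $d-r$ is even, and let $\mathcal P\subset\mathbb R^d$ be an integral convex polytope of dimension $d$. Then $$g_r(\mathcal P)\ \ge\ \frac{1}{d!}\Big(\mathrm{stirl}(d+1,r+1)+(d!\,\mathrm{vol}(\mathcal P)-1)\,M_{r,d}\Big),$$ and this bound is best possible for any volume: for every positive integer $m$ there exists an integral convex polytope $\mathcal P$ of dimension $d$ with $d!\,\mathrm{vol}(\mathcal P)=m$ for which equality holds.
   Context: An integral convex polytope is a convex polytope in $\mathbb R^d$ all of whose vertices lie in $\mathbb Z^d$. For such $\mathcal P$ of dimension $d$, the Ehrhart polynomial is $L_{\mathcal P}(n)=|n\mathcal P\cap\mathbb Z^d|$ (a polynomial in $n$ of degree $d$), and $g_r(\mathcal P)$ denotes the coefficient of $n^r$ in $L_{\mathcal P}(n)$. $\mathrm{vol}$ is the usual $d$-dimensional volume. The Stirling numbers of the first kind $\mathrm{stirl}(d,i)$ are defined by $\prod_{i=0}^{d-1}(z-i)=\sum_{i=1}^d \mathrm{stirl}(d,i)z^i$. For integers $i$ and $d$, let $c_i(z)=(z+i)(z+i-1)\cdots(z+i-(d-1))=d!\binom{z+i}{d}$, and let $C^d_{r,i}$ denote the coefficient of $z^r$ in $c_i(z)$. For $d\ge3$, $M_{r,d}=\min\{C^d_{r,i}: 1\le i\le d-2\}$. *)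

(* Defs.v *)
From mathcomp Require Import all_boot all_order all_algebra finmap.
From mathcomp Require Import all_classical all_reals all_analysis.
Set Implicit Arguments.
Unset Strict Implicit.
Unset Printing Implicit Defensive.
Import Order.TTheory GRing.Theory Num.Theory.
Local Open Scope classical_set_scope.
Local Open Scope ring_scope.

(* stirl(d, i): signed Stirling number of the first kind; for d >= 1 the
   coefficient of z^0 vanishes, so the sum over 1 <= i <= d is the whole
   polynomial. *)
Definition stirl (d i : nat) : int :=
  (\prod_(0 <= k < d) ('X - (k%:Z)%:P) : {poly int})`_i.

Definition c_poly (d : nat) (i : int) : {poly int} :=
  \prod_(0 <= k < d) ('X + (i - k%:Z)%:P).

Definition Ccoef (d r : nat) (i : int) : int := (c_poly d i)`_r.

(* The range 1 <= i <= d - 2 is nonempty for d >= 3; the initial value is its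
   first term, so it does not affect the minimum. *)
Definition M_min (r d : nat) : int :=
  \big[Order.min/Ccoef d r 1]_(1 <= i < d.-1) Ccoef d r i%:Z.

Section Polytopes.
Context (R : realType) (d : nat).
Implicit Types (P A : set 'rV[R]_d).

Definition conv_hull A : set 'rV[R]_d :=
  smallest (@convex_set R 'rV[R]_d) A.

Definition convex_polytope P : Prop :=
  exists s : seq 'rV[R]_d, P = conv_hull [set` s].

(* Vertices, as extreme points. *)
Definition vertex P (v : 'rV[R]_d) : Prop :=
  P v /\ forall (x y : 'rV[R]_d) (t : R), P x -> P y -> 0 < t < 1 ->
    v = t *: x + (1 - t) *: y -> x = v /\ y = v.

Definition Zlattice : set 'rV[R]_d :=
  [set x | forall i, x ord0 i \is a Num.int].

Definition integral_polytope P : Prop :=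
  convex_polytope P /\ vertex P `<=` Zlattice.

Definition affine_hull A : set 'rV[R]_d :=
  [set x | exists n (p : 'I_n -> 'rV[R]_d) (l : 'I_n -> R),
     [/\ forall i, A (p i), \sum_(i < n) l i = 1 &
         x = \sum_(i < n) l i *: p i]].

Definition has_dim P (k : nat) : Prop :=
  exists (x0 : 'rV[R]_d) (W : {vspace 'rV[R]_d}),
    \dim W = k /\ affine_hull P = [set x0 + w | w in [set` W]].

Definition dilate (n : nat) P : set 'rV[R]_d := [set n%:R *: x | x in P].

(* L_P(n) as a cardinal: [fset_set] is only meaningful on finite sets, which is
   the case here because polytopes are bounded. *)
Definition lattice_count P (n : nat) : nat :=
  #|` fset_set (dilate n P `&` Zlattice)|%fset.

(* The unique polynomial agreeing with L_P at all positive integers, when there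
   is one (0 otherwise). *)
Definition ehrhart_poly P : {poly R} :=
  xget 0 [set L : {poly R} |
    forall n : nat, (0 < n)%N -> L.[n%:R] = (lattice_count P n)%:R].

Definition ehrhart_coef (r : nat) P : R := (ehrhart_poly P)`_r.

Definition box (a b : 'rV[R]_d) : set 'rV[R]_d :=
  [set x | forall i, a ord0 i <= x ord0 i <= b ord0 i].

(* Lebesgue outer measure on R^d, by countable covers with closed boxes; on
   Borel sets, hence on polytopes, it is the Lebesgue measure. *)
Definition lebesgue_outer A : \bar R :=
  ereal_inf [set s : \bar R | exists a b : nat -> 'rV[R]_d,
    [/\ forall k i, a k ord0 i <= b k ord0 i,
        A `<=` \bigcup_k box (a k) (b k) &
        s = (\sum_(0 <= k <oo)
               (\prod_(i < d) (b k ord0 i - a k ord0 i))%:E)%E]].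

Definition vol A : R := fine (lebesgue_outer A).

End Polytopes.

(* Main.v *)
(* Homogenizing, [P] is the height-1 slice of the cone spanned by the vectors
   [(1, v)], [v] a vertex. For generic costs, the bases that are optimal for the
   linear program "write y as a nonnegative combination of least cost" triangulate
   this cone, and pushing every point slightly in a generic direction assigns it to
   exactly one of these simplicial cones; so the cone is a disjoint union of half-open
   simplicial cones. The lattice points of a half-open simplicial cone are the
   translates of those of its fundamental box by nonnegative combinations of the
   generators. Hence [L_P(n)] is a sum of binomials ['C(n + i, d)] with [0 <= i <= d],
   one for each lattice point of height [d - i] of the boxes, and [i = d] occurs
   exactly once (Stanley's nonnegativity of the h*-vector, with h*_0 = 1). The leading
   coefficient shows that there are [d! vol P] terms, and the coefficient of [z^r] in
   ['C(z + i, d)] is [C^d_{r,i} / d!]. For [d - r] even, [C^d_{r,i}] is symmetric under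
   [i -> d - 1 - i] and [C^d_{r,1} <= C^d_{r,0}], so [M_{r,d}] bounds all terms other
   than [i = d]. Equality holds for a simplex whose nonzero box points all have the
   same height [k], where [M_{r,d} = C^d_{r,d-k}] and, by the symmetry,
   [2 k <= d + 1]. *)
Require Import Defs.
From mathcomp Require Import all_boot all_order all_algebra finmap.
From mathcomp Require Import all_classical all_reals all_analysis.
From mathcomp Require Import zify ring lra.
Set Implicit Arguments.
Unset Strict Implicit.
Unset Printing Implicit Defensive.
Import Order.TTheory GRing.Theory Num.Theory.
Import numFieldNormedType.Exports.
Local Open Scope classical_set_scope.
Local Open Scope ring_scope.

(** * Symmetry and signs of the coefficients C^d_{r,i} *)

Lemma c_poly_reflect (d : nat) (i : int) :
  c_poly d (d%:Z - 1 - i) = (-1) ^+ d *: (c_poly d i \Po - 'X).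
Proof.
rewrite /c_poly !big_mkord rmorph_prod /= -mul_polyC rmorphXn rmorphN1.
rewrite -[in X in (-1) ^+ X](card_ord d) -prodr_const -big_split /=.
(* Factor [d - 1 - k] on the left is the negative of factor [k] on the right. *)
rewrite (reindex_inj rev_ord_inj) /=; apply: eq_bigr => k _.
rewrite comp_polyD comp_polyX comp_polyC mulN1r opprD opprK -polyCN.
congr (_ + _%:P); have := ltn_ord k; lia.
Qed.

Lemma coef_comp_oppX (R : comNzRingType) (p : {poly R}) r :
  (p \Po - 'X)`_r = (-1) ^+ r * p`_r.
Proof.
rewrite -scaleN1r; elim/poly_ind: p r => [|p c IH] r.
  by rewrite comp_poly0 coef0 mulr0.
rewrite comp_poly_MXaddC !coefD !coefC -scalerAr coefZ !coefMX mulrDr.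
by case: r => [|r] /=; rewrite ?IH ?mulr0 ?expr0 ?mul1r // exprS !addr0 mulrA.
Qed.

Lemma Ccoef_reflect (d r : nat) (i : int) : (r <= d)%N ->
  Ccoef d r (d%:Z - 1 - i) = (-1) ^+ (d - r) * Ccoef d r i.
Proof.
move=> rd; rewrite /Ccoef c_poly_reflect coefZ coef_comp_oppX mulrA -exprD.
by rewrite -(signr_odd _ (d + r)) oddD -oddB // signr_odd.
Qed.

Lemma Ccoef_pos_ge0 (d r : nat) (i : int) : d%:Z - 1 <= i -> 0 <= Ccoef d r i.
Proof.
rewrite /Ccoef /c_poly big_mkord => di.
elim/big_rec: _ r => [|k p _ IH] r; first by rewrite coef1; case: eqP.
rewrite mulrDl coefD coefXM coefCM addr_ge0 //; first by case: eqP.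
by rewrite mulr_ge0 //; have := ltn_ord k; lia.
Qed.

(** The products for [0] and [1] share all factors but one, so their difference is [- d] times the
    product for [0] in dimension [d - 1]. There [d - 1 - r] is odd, and reflection turns the
    coefficient into minus one of a product with nonnegative constants. *)
Lemma Ccoef_pred_le (d r : nat) : (0 < d)%N -> (r < d)%N -> ~~ odd (d - r) ->
  Ccoef d r 1 <= Ccoef d r 0.
Proof.
case: d => // d _ rd odr; rewrite -subr_ge0.
have -> : Ccoef d.+1 r 0 - Ccoef d.+1 r 1 = - (d.+1%:R * Ccoef d r 0).
  rewrite /Ccoef -coefB.
  have -> : c_poly d.+1 0 - c_poly d.+1 1 = - (d.+1%:R *: c_poly d 0) :> {poly int}.
    have e0 : c_poly d.+1 0 = c_poly d 0 * ('X - d%:Z%:P).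
      by rewrite /c_poly big_nat_recr //= sub0r polyCN.
    have e1 : c_poly d.+1 1 = ('X + 1) * c_poly d 0.
      rewrite /c_poly big_nat_recl //= subr0; congr (_ * _).
      by apply: eq_bigr => k _; congr (_ + _%:P); lia.
    rewrite e0 e1 -mul_polyC.
    have -> : d.+1%:R%:P = d%:Z%:P + 1 :> {poly int}.
      by rewrite -polyC1 -polyCD; congr (_%:P); lia.
    ring.
  by rewrite coefN coefZ.
have rd' : (r <= d)%N by [].
have := @Ccoef_reflect d r (d%:Z - 1) rd'; rewrite subrr => ->.
rewrite -signr_odd.
have -> : odd (d - r) by move: odr; rewrite subSn //= negbK.
by rewrite expr1 mulN1r mulrN opprK mulr_ge0 // Ccoef_pos_ge0.
Qed.

(** The product z (z - 1) ... (z - d) is z times the [c_poly] of index [-1], and [-1] reflects to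
    [d]. *)
Lemma stirl_Ccoef (d r : nat) : (r <= d)%N -> ~~ odd (d - r) ->
  stirl d.+1 r.+1 = Ccoef d r d%:Z.
Proof.
move=> rd odr.
have -> : d%:Z = d%:Z - 1 - (-1) by rewrite opprK subrK.
rewrite Ccoef_reflect // -signr_odd (negbTE odr) mul1r /stirl /Ccoef.
rewrite big_nat_recl //= subr0 mulrC coefMX /=.
apply: (congr1 (fun p : {poly int} => p`_r)); rewrite /c_poly.
apply: eq_bigr => k _.
by rewrite -polyCN; congr (_ + _%:P); lia.
Qed.

Lemma M_min_le (r d : nat) (i : nat) : (1 <= i < d.-1)%N ->
  M_min r d <= Ccoef d r i%:Z.
Proof.
move=> hi; rewrite /M_min.
by apply: ge_bigmin_seq => //; rewrite mem_index_iota.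
Qed.

Lemma M_min_attained (r d : nat) : (3 <= d)%N ->
  exists2 i : nat, (1 <= i < d.-1)%N & M_min r d = Ccoef d r i%:Z.
Proof.
move=> d3; rewrite /M_min big_nat.
elim/big_ind: _ => [|x y [i hi ->] [j hj ->]|i].
- by exists 1%N => //; lia.
- by case: (leP (Ccoef d r i%:Z) (Ccoef d r j%:Z)) => _; [exists i|exists j].
- by exists i.
Qed.

(** * Binomial sums, leading coefficients and elementary estimates for polynomials *)

Lemma prod_linear (R : nzRingType) (d : nat) (c a : 'I_d -> R)
    (p := \prod_(i < d) (c i *: 'X + (a i)%:P)) :
  (size p <= d.+1)%N /\ p`_d = \prod_(i < d) c i.
Proof.
rewrite {}/p; elim: d c a => [|d IH] c a.
  by rewrite !big_ord0 coef1 size_poly1.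
have [IH1 IH2] := IH (fun i => c (lift ord0 i)) (fun i => a (lift ord0 i)).
rewrite !big_ord_recl mulrDl -scalerAl; split.
  apply: leq_trans (size_polyD _ _) _; rewrite geq_max.
  apply/andP; split.
    apply: leq_trans (size_scale_leq _ _) _.
    by apply: leq_trans (size_polyMleq _ _) _; rewrite size_polyX.
  apply: leq_trans (size_polyMleq _ _) _; apply: leq_trans (leqW IH1).
  by have := size_polyC_leq1 (a ord0); case: (size _) => [|[]] // _; exact: leq_pred.
rewrite coefD coefZ coefXM coefCM /= IH2 [X in _ + a ord0 * X]nth_default ?mulr0 ?addr0 //.
Qed.

Lemma c_poly_map (R : nzRingType) (d : nat) (i : int) :
  map_poly (intr : int -> R) (c_poly d i) = \prod_(k < d) ('X + (i - k%:Z)%:~R%:P).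
Proof.
rewrite /c_poly big_mkord rmorph_prod /=; apply: eq_bigr => k _.
by rewrite rmorphD /= map_polyX map_polyC.
Qed.

Lemma c_poly_lead (R : nzRingType) (d : nat) (i : int)
    (p := map_poly (intr : int -> R) (c_poly d i)) :
  (size p <= d.+1)%N /\ p`_d = 1.
Proof.
rewrite /p c_poly_map.
have := @prod_linear R d (fun=> 1) (fun k => (i - k%:Z)%:~R).
rewrite /= prodr_const expr1n.
by under eq_bigr do rewrite scale1r.
Qed.

Lemma c_poly_binomial (R : comNzRingType) (d n i : nat) :
  (map_poly (intr : int -> R) (c_poly d i%:Z)).[n%:R] = (d`! * 'C(n + i, d))%N%:R.
Proof.
rewrite c_poly_map horner_prod mulnC bin_ffact.
set N := (n + i)%N.
transitivity (\prod_(k < d) (N%:Z - k%:Z)%:~R : R).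
  apply: eq_bigr => k _; rewrite !hornerE /N -[n%:R]/(n%:Z%:~R) -intrD.
  by congr (_%:~R); lia.
rewrite -rmorph_prod /= -[RHS]/((N ^_ d)%N%:Z%:~R); congr (_%:~R).
elim: {+}d => [|m IH]; first by rewrite big_ord0 ffactn0.
rewrite big_ord_recr /= IH ffactnSr PoszM.
have [mN|Nm] := leqP m N; first by congr (_ * _); lia.
(* Here the truncated [N - m] differs from the integer difference, but the preceding falling
   factorial is already zero. *)
by rewrite ffact_small // !mul0r.
Qed.

Definition binomial_sum_poly (R : realType) (d : nat) (I : seq nat) : {poly R} :=
  (d`!%:R)^-1 *: \sum_(i <- I) map_poly (intr : int -> R) (c_poly d i%:Z).

Lemma binomial_sum_polyE (R : realType) (d : nat) (I : seq nat) (n : nat) :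
  (binomial_sum_poly R d I).[n%:R] = (\sum_(i <- I) 'C(n + i, d))%N%:R.
Proof.
rewrite /binomial_sum_poly hornerZ horner_sum natr_sum mulr_sumr.
apply: eq_bigr => i _; rewrite c_poly_binomial natrM mulrA mulVf ?mul1r //.
Qed.

Lemma coef_binomial_sum_poly (R : realType) (d r : nat) (I : seq nat) :
  (binomial_sum_poly R d I)`_r = (d`!%:R)^-1 * (\sum_(i <- I) Ccoef d r i%:Z)%:~R.
Proof.
rewrite /binomial_sum_poly coefZ coef_sum rmorph_sum /=; congr (_ * _).
by apply: eq_bigr => i _; rewrite coef_map.
Qed.

Lemma binomial_sum_poly_lead (R : realType) (d : nat) (I : seq nat) :
  (size (binomial_sum_poly R d I) <= d.+1)%N /\
  (binomial_sum_poly R d I)`_d = (size I)%:R / d`!%:R.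
Proof.
split.
  apply: leq_trans (size_scale_leq _ _) _; apply: leq_trans (size_sum _ _ _) _.
  by apply/bigmax_leqP_seq => i _ _; have [] := c_poly_lead R d i.
rewrite /binomial_sum_poly coefZ coef_sum mulrC; congr (_ * _).
rewrite -sum1_size natr_sum; apply: eq_bigr => i _.
by have [] := c_poly_lead R d i.
Qed.

(** This gives uniqueness of the polynomial chosen in [ehrhart_poly]. *)
Lemma poly_eq_nat (R : realType) (p q : {poly R}) :
  (forall n : nat, (0 < n)%N -> p.[n%:R] = q.[n%:R]) -> p = q.
Proof.
move=> pq; apply/eqP; rewrite -subr_eq0; apply: contraTT isT.
have : forall n : nat, (0 < n)%N -> (p - q).[n%:R] = 0.
  by move=> n n0; rewrite hornerD hornerN pq // subrr.
move: (p - q) => {pq}u pq pq0.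
pose rs : seq R := [seq k.+1%:R | k <- iota 0 (size u)].
have : (size rs < size u)%N.
  apply: (max_poly_roots pq0).
    by apply/allP => _ /mapP[k _ ->]; rewrite /root pq.
  by rewrite map_inj_uniq ?iota_uniq // => k l /eqP; rewrite eqr_nat => /eqP[].
by rewrite size_map size_iota ltnn.
Qed.

(** After division by n^(d-1), the terms of lower degree are bounded, so a negative coefficient of
    degree [d] would win for large [n]. Volumes and lattice point counts are compared through this
    lemma. *)
Lemma poly_nonneg_coef (R : realType) (p : {poly R}) (d : nat) :
  (size p <= d.+1)%N -> (forall n : nat, (0 < n)%N -> 0 <= p.[n%:R]) -> 0 <= p`_d.
Proof.
move=> sp hp; rewrite leNgt; apply/negP => pd.
case: d sp pd => [|d] sp pd.
  by have := hp 1%N isT; rewrite (size1_polyC sp) hornerC leNgt pd.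
pose M := \sum_(i < d.+1) `|p`_i|.
have M0 : 0 <= M by apply: sumr_ge0.
have key (n : nat) : (0 < n)%N -> 0 <= p`_d.+1 * n%:R + M.
  move=> n0; have n0' : 0 < n%:R ^+ d :> R by rewrite exprn_gt0 // ltr0n.
  rewrite -(pmulr_lge0 _ n0') mulrDl -mulrA -exprS.
  apply: le_trans (hp n n0) _.
  rewrite (horner_coef_wide _ sp) big_ord_recr /= addrC lerD2l mulr_suml.
  apply: ler_sum => i _; apply: le_trans (ler_norm _) _; rewrite normrM.
  rewrite ler_wpM2l // ger0_norm ?exprn_ge0 // ler_weXn2l ?ler1n //.
  by rewrite -ltnS.
have := key (Num.truncn (M / - p`_d.+1)).+1 isT.
have : M / - p`_d.+1 < (Num.truncn (M / - p`_d.+1)).+1%:R by exact: truncnS_gt.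
rewrite ltr_pdivrMr ?oppr_gt0 // => h1 h2; lra.
Qed.

(** For [h <= 1] the increase from [0] to [h] is at most [h] times the sum of the absolute values of
    the coefficients. It controls the volume gained when covering boxes are thickened. *)
Lemma poly_small_increase (R : realType) (p : {poly R}) (e : R) : 0 < e ->
  exists2 h : R, 0 < h & p.[h] <= p.[0] + e.
Proof.
move=> e0; pose M := \sum_(i < size p) `|p`_i|.
have M0 : 0 <= M by apply: sumr_ge0.
pose h := Num.min 1 (e / (M + 1)).
have h0 : 0 < h by rewrite lt_min ltr01 divr_gt0 //; lra.
have h1 : h <= 1 by rewrite ge_min lexx.
exists h => //; have hM : h * M <= e.
  have : h <= e / (M + 1) by rewrite ge_min lexx orbT.
  by rewrite ler_pdivlMr; [nra|lra].
have [->|pn] := eqVneq p 0; first by rewrite !horner0 add0r ltW.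
have sp : (0 < size p)%N by rewrite size_poly_gt0.
apply: le_trans (lerD (lexx p.[0]) hM); rewrite horner_coef0 horner_coef /M.
case: (size p) sp => // m _; rewrite !big_ord_recl expr0 mulr1 lerD2l mulrDr ler_wpDl
  ?mulr_ge0 ?(ltW h0) //.
rewrite mulr_sumr; apply: ler_sum => i _; apply: le_trans (ler_norm _) _.
rewrite normrM (ger0_norm (exprn_ge0 _ (ltW h0))) mulrC ler_wpM2r // lift0 exprS.
by rewrite ler_piMr ?(ltW h0) // exprn_ile1 // ltW.
Qed.

(** * Triangulating a cone into half-open simplicial cones *)

Section ConeTriangulation.
Context {R : realFieldType}.

(** Take the powers of some [s > 0]: a nonzero [g i] is the coefficient vector of a nonzero
    polynomial, and [s] only has to avoid the finitely many roots of the product of these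
    polynomials. *)
Lemma generic_positive_vector (N : nat) (I : finType) (g : I -> 'cV[R]_N) :
  exists w : 'rV[R]_N, (forall k, 0 < w 0 k) /\
    forall i, g i != 0 -> (w *m g i) 0 0 != 0.
Proof.
pose p i : {poly R} := rVpoly (g i)^T.
pose P := \prod_(i | g i != 0) p i.
have P0 : P != 0.
  apply/prodf_neq0 => i gi; apply: contraNneq gi => pi0.
  by rewrite -[g i]trmxK -[(g i)^T]rVpolyK -/(p i) pi0 linear0 trmx0.
have [s /andP[s0 rs]] : exists s : R, (0 < s) && ~~ root P s.
  apply: contrapT => /forallNP H.
  pose rs : seq R := [seq k.+1%:R | k <- iota 0 (size P)].
  have : (size rs < size P)%N.
    apply: (max_poly_roots P0).
      apply/allP => _ /mapP[k _ ->].
      by have /negP := H k.+1%:R; rewrite ltr0n /= negbK.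
    by rewrite map_inj_uniq ?iota_uniq // => k l /eqP; rewrite eqr_nat => /eqP[].
  by rewrite size_map size_iota ltnn.
exists (\row_k s ^+ k); split=> [k|i gi]; first by rewrite mxE exprn_gt0.
have : (p i).[s] != 0.
  apply: contraNneq rs => pis; rewrite /root /P horner_prod.
  by apply/prodf_eq0; exists i => //; rewrite pis.
apply: contraNneq => <-; rewrite horner_poly !mxE; apply/eqP.
by apply: eq_bigr => k _; rewrite valK !mxE mulrC.
Qed.

Lemma perturbation_sign (I : finType) (a b : I -> R) :
  exists2 e : R, 0 < e & forall i, b i != 0 ->
    (a i + e * b i != 0) /\
    (0 < a i + e * b i) = (if b i < 0 then 0 < a i else 0 <= a i).
Proof.
(* Terms with [a i = 0] vanish because division by zero yields zero; for the others,
   [e = 1 / (1 + S)] makes [e * b i] smaller than [a i] in absolute value. *)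
pose S := \sum_i `|b i| / `|a i|.
have S0 : 0 <= S by apply: sumr_ge0 => i _; rewrite divr_ge0.
have S1 : 0 < 1 + S by lra.
exists (1 + S)^-1 => [|i bi]; first by rewrite invr_gt0.
set e := (1 + S)^-1; have e0 : 0 < e by rewrite invr_gt0.
have [ai|ai] := eqVneq (a i) 0.
  rewrite ai add0r pmulr_rgt0 // ltxx lexx; split; last by case: ltgtP bi.
  by rewrite mulf_neq0 // gt_eqF.
have small : `|e * b i| < `|a i|.
  rewrite normrM (gtr0_norm e0) mulrC ltr_pdivrMr // mulrDr mulr1.
  have : `|b i| / `|a i| <= S.
    by rewrite /S (bigD1 i) //= lerDl; apply: sumr_ge0 => k _; rewrite divr_ge0.
  rewrite ler_pdivrMr ?normr_gt0 // => /le_lt_trans; apply.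
  by rewrite mulrC ltrDr normr_gt0.
have [ap|an|/esym/eqP] := ltgtP 0 (a i); last by rewrite (negbTE ai).
- move: small; rewrite (gtr0_norm ap) ltr_norml => /andP[h _].
  have h' : 0 < a i + e * b i by lra.
  by rewrite gt_eqF // h'; case: ifP.
- move: small; rewrite (ltr0_norm an) ltr_norml opprK => /andP[_ h].
  have h' : a i + e * b i < 0 by lra.
  by rewrite lt_eqF // (lt_gtF h'); case: ifP.
Qed.

Context (N D : nat) (A : 'M[R]_(N, D)).
Implicit Types (s t : {set 'I_N}) (l m : 'rV[R]_N) (x y q : 'rV[R]_D).

(* Subfamilies of the rows of [A] are given by index sets [s]; coefficient vectors on
   [s] are kept as vectors on all indices that vanish off [s]. *)
Definition mask s : 'M[R]_N := diag_mx (\row_i (i \in s)%:R).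
Definition indep s := forall l, l *m mask s *m A = 0 -> l *m mask s = 0.
Definition is_basis s := indep s /\ row_full (mask s *m A).
(* [x *m coords s] is only meaningful when [s] is a basis ([pinvmx] is junk otherwise). *)
Definition coords s : 'M[R]_(D, N) := pinvmx (mask s *m A) *m mask s.
Definition support l : {set 'I_N} := [set i | l 0 i != 0].

Lemma mul_maskE l s i : (l *m mask s) 0 i = l 0 i * (i \in s)%:R.
Proof. by rewrite mul_mx_diag !mxE. Qed.

Lemma mul_mask_id l s : (forall i, i \notin s -> l 0 i = 0) -> l *m mask s = l.
Proof.
move=> H; apply/rowP => i; rewrite mul_maskE.
by case: (boolP (i \in s)) => [_|/H ->]; rewrite ?mulr1 ?mul0r.
Qed.

Lemma mask_idem s : mask s *m mask s = mask s.
Proof.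
apply/row_matrixP => i; rewrite row_mul; apply: mul_mask_id => j js.
by rewrite !mxE; case: eqP => // ->; rewrite (negbTE js).
Qed.

Lemma mask_support l : l *m mask (support l) = l.
Proof. by apply: mul_mask_id => i; rewrite inE negbK => /eqP. Qed.

Lemma coords_off x s i : i \notin s -> (x *m coords s) 0 i = 0.
Proof. by move=> si; rewrite mulmxA mul_maskE (negbTE si) mulr0. Qed.

Lemma coordsK s : row_full (mask s *m A) -> coords s *m A = 1%:M.
Proof. by move=> rf; rewrite /coords -mulmxA mulVpmx. Qed.

Lemma indep_inj s l m : indep s -> (forall i, i \notin s -> l 0 i = 0) ->
  (forall i, i \notin s -> m 0 i = 0) -> l *m A = m *m A -> l = m.
Proof.
move=> ind hl hm e; apply/eqP; rewrite -subr_eq0; apply/eqP.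
have lm : (l - m) *m mask s = l - m by rewrite mulmxBl !mul_mask_id.
by rewrite -lm ind // lm mulmxBl e subrr.
Qed.

Lemma coords_uniq s l : is_basis s -> (forall i, i \notin s -> l 0 i = 0) ->
  l *m A *m coords s = l.
Proof.
move=> [ind rf] hl; apply: (indep_inj ind) => // [i|]; first exact: coords_off.
by rewrite -mulmxA coordsK // mulmx1.
Qed.

Lemma coords_row s i : is_basis s -> i \in s ->
  row i A *m coords s = delta_mx 0 i.
Proof.
move=> bs si; rewrite rowE; apply: coords_uniq => // j js.
by rewrite mxE eqxx /=; case: eqP => // ji; rewrite ji si in js.
Qed.

(** Compute a trace in both cyclic orders: [coords s *m A] is the identity of size [D], while
    [mask s *m A *m coords s] is the projection [mask s], of trace [#|s|]. *)
Lemma card_basis s : is_basis s -> #|s| = D.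
Proof.
move=> bs; apply/eqP; rewrite -(@eqr_nat R); apply/eqP.
have -> : D%:R = \tr (coords s *m (mask s *m A)).
  by rewrite mulmxA -[in RHS](mulmxA (pinvmx _)) mask_idem coordsK ?mxtrace1 //; case: bs.
rewrite mxtrace_mulC.
have -> : mask s *m A *m coords s = mask s.
  apply/row_matrixP => i; rewrite !row_mul; apply: coords_uniq => // j js.
  by rewrite !mxE; case: eqP => // ->; rewrite (negbTE js).
rewrite /mxtrace -sum1_card natr_sum big_mkcond /=.
by apply: eq_bigr => i _; rewrite !mxE eqxx; case: (i \in s).
Qed.

Context (h : 'cV[R]_D) (hA : A *m h = const_mx 1).

Lemma sum_heights l : l *m A = 0 -> \sum_i l 0 i = 0.
Proof.
move=> lA; transitivity ((l *m A *m h) 0 0); last by rewrite lA mul0mx mxE.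
by rewrite -mulmxA hA mxE; apply: eq_bigr => i _; rewrite mxE mulr1.
Qed.

(* Moving along a linear dependence on the support until a coefficient vanishes;
   since heights are positive, the dependence has entries of both signs, so its
   orientation may be chosen not to increase the cost. *)
Lemma reduce_support (w : 'cV[R]_N) l : (forall i, 0 <= l 0 i) ->
  exists m, [/\ forall i, 0 <= m 0 i, m *m A = l *m A,
                (m *m w) 0 0 <= (l *m w) 0 0 & indep (support m)].
Proof.
have [n] := ubnP #|support l|; elim: n l => // n IH l; rewrite ltnS => ln l0.
have [ind|] := pselect (indep (support l)); first by exists l.
move=> /existsNP[m0 /not_implyP[m0A /eqP m0n]].
pose m1 := m0 *m mask (support l); pose m := (if (m1 *m w) 0 0 <= 0 then m1 else - m1).
have mA : m *m A = 0 by rewrite /m; case: ifP => _; rewrite ?mulNmx m0A ?oppr0.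
have mn : m != 0 by rewrite /m; case: ifP => _; rewrite ?oppr_eq0.
have ms i : l 0 i = 0 -> m 0 i = 0.
  move=> li; suff m1i : m1 0 i = 0 by rewrite /m; case: ifP => _ //;
    rewrite [LHS]mxE m1i oppr0.
  by rewrite mul_maskE inE li eqxx mulr0.
have mw : (m *m w) 0 0 <= 0.
  rewrite /m; case: ifP => // /negbT; rewrite -ltNge => /ltW.
  by rewrite mulNmx [X in _ -> X <= 0]mxE oppr_le0.
have [i0 i0n] : exists i, m 0 i < 0.
  apply: contrapT => /forallNP H; have H' i : 0 <= m 0 i by rewrite leNgt; apply/negP/H.
  move: mn => /negP; apply; apply/eqP/rowP => i; rewrite mxE; apply/eqP.
  have /eqP := sum_heights mA; rewrite psumr_eq0; last by move=> ? _; exact: H'.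
  by move=> /allP /(_ i); rewrite mem_index_enum => /(_ isT).
case: (@Order.TotalTheory.arg_minP _ _ _ i0 (fun i => m 0 i < 0) (fun i => l 0 i / - m 0
  i) i0n).
move=> i1 i1n i1min; set e := l 0 i1 / - m 0 i1 in i1min.
have e0 : 0 <= e by rewrite divr_ge0 // oppr_ge0 ltW.
pose l' := l + e *: m.
have l'0 i : 0 <= l' 0 i.
  rewrite !mxE; have [mi|mi] := leP 0 (m 0 i); first by rewrite addr_ge0 // mulr_ge0.
  have := i1min i mi; rewrite ler_pdivlMr ?oppr_gt0 // mulrN; lra.
have l'A : l' *m A = l *m A by rewrite mulmxDl -scalemxAl mA scaler0 addr0.
have l'w : (l' *m w) 0 0 <= (l *m w) 0 0.
  by rewrite mulmxDl -scalemxAl !mxE gerDl mulr_ge0_le0 //; move: mw; rewrite mxE.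
have l's : (#|support l'| < n)%N.
  apply: leq_trans ln; apply: proper_card; apply/properP; split.
    apply/fintype.subsetP => i; rewrite !inE; apply: contraNneq => li.
    by rewrite !mxE li ms // mulr0 addr0.
  exists i1; rewrite !inE.
    by apply: contraTneq i1n => /ms ->; rewrite ltxx.
  by rewrite negbK !mxE /e invrN mulrN mulNr divfK ?subrr // lt_eqF.
have [m' [? m'A m'w ?]] := IH l' l's l'0.
by exists m'; split => //; [rewrite m'A|exact: le_trans l'w].
Qed.

(* [y] lies in no proper subspace spanned by rows of [A]. *)
Definition generic y := forall s, y *m cokermx (mask s *m A) = 0 -> row_full (mask s *m A).
(* Positivity of the reduced costs: [s] is the optimal basis for every vector of its cone. *)
Definition tight (w : 'cV[R]_N) s := is_basis s /\
  forall j, j \notin s -> (row j A *m coords s *m w) 0 0 < w j 0.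

Lemma generic_support y l : generic y -> l *m A = y -> row_full (mask (support l) *m A).
Proof.
by move=> g lA; apply: g; rewrite -lA -{1}(mask_support l) -(mulmxA l) -mulmxA
  mulmx_coker mulmx0.
Qed.

(** If coordinate [i] vanished, [y] would lie in the span of other rows of [s]. By genericity these
    would span everything, row [i] included, against the independence of [s]. *)
Lemma generic_coords_neq0 y s i : generic y -> is_basis s -> i \in s ->
  (y *m coords s) 0 i != 0.
Proof.
move=> g bs si; apply/eqP => yi.
have [ind rf] := bs.
have yA : y *m coords s *m A = y by rewrite -mulmxA coordsK ?mulmx1.
have rf' := generic_support g yA.
set u := support _ in rf'.
have us : u \subset s.
  by apply/fintype.subsetP => j; rewrite inE; apply: contraR => /coords_off ->.
have : row i A *m coords u = delta_mx 0 i.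
  apply: (indep_inj ind) => [j js|j js|].
  - by apply: coords_off; apply: contra js => /(fintype.subsetP us).
  - by rewrite mxE eqxx /=; case: eqP => // ji; rewrite ji si in js.
  - by rewrite -mulmxA coordsK // mulmx1 -rowE.
move/matrixP => /(_ 0 i); rewrite coords_off; last by rewrite inE yi eqxx.
by rewrite mxE !eqxx => /eqP; rewrite eq_sym oner_eq0.
Qed.

(** Among the finitely many bases in which [y] has nonnegative coordinates, take one of least cost.
    A row outside it with negative reduced cost would give a cheaper combination, and
    [reduce_support] would turn that into a cheaper basis. *)
Lemma tight_exists (w : 'cV[R]_N) y l :
  (forall s j, is_basis s -> j \notin s -> (row j A *m coords s *m w) 0 0 != w j 0) ->
  generic y -> (forall i, 0 <= l 0 i) -> l *m A = y ->
  exists2 s, tight w s & forall i, i \in s -> 0 < (y *m coords s) 0 i.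
Proof.
move=> gw gy l0 lA.
pose feas s := `[< is_basis s /\ forall i, 0 <= (y *m coords s) 0 i >].
pose cost s := (y *m coords s *m w) 0 0.
have red m : (forall i, 0 <= m 0 i) -> m *m A = y -> exists2 s,
  feas s & cost s <= (m *m w) 0 0.
  move=> m0 mA; have [m' [m'0 m'A m'w ind]] := reduce_support w m0.
  have bs : is_basis (support m').
    by split => //; apply: (@generic_support y); rewrite ?m'A.
  have e : y *m coords (support m') = m'.
    by rewrite -mA -m'A coords_uniq // => i; rewrite inE negbK => /eqP.
  exists (support m'); last by rewrite /cost e.
  by apply/asboolP; split => // i; rewrite e.
have [s0 s0f _] := red _ l0 lA.
case: (@Order.TotalTheory.arg_minP _ _ _ s0 feas cost s0f) => s /asboolP[bs sp] smin.
have spos i : i \in s -> 0 < (y *m coords s) 0 i.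
  by move=> si; rewrite lt0r generic_coords_neq0 ?sp.
exists s => //; split => // j js; rewrite lt_neqAle gw //=.
pose c := row j A *m coords s.
have [e e0 He] := perturbation_sign (fun i => (y *m coords s) 0 i) (fun i => - c 0 i).
(* Bring in [e] units of row [j] and remove its expansion in [s]; the coordinates of [y] on [s] are
   strictly positive, so nonnegativity survives for small [e]. *)
pose m := y *m coords s + e *: (delta_mx 0 j - c).
have mA : m *m A = y.
  have CA : coords s *m A = 1%:M by apply: coordsK; case: bs.
  by rewrite mulmxDl -scalemxAl mulmxBl -rowE /c -!(mulmxA _ (coords s)) CA !mulmx1 subrr
    scaler0 addr0.
have m0 i : 0 <= m 0 i.
  have -> : m 0 i = (y *m coords s) 0 i + e * ((i == j)%:R - c 0 i).
    by rewrite /m; move: (y *m coords s) (c) => u v; rewrite !mxE eqxx.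
  have [->|ij] := eqVneq i j.
    have -> : c 0 j = 0 by exact: coords_off.
    by rewrite subr0 mulr1 addr_ge0 // ltW.
  rewrite sub0r; have [cn|cn] := eqVneq (- c 0 i) 0; first by rewrite cn mulr0 addr0.
  have [_ E] := He i cn; apply: ltW; rewrite E.
  have si : i \in s.
    by apply: contraNT cn => /(coords_off (row j A)); rewrite -/c => ->; rewrite oppr0.
  by rewrite sp spos ?if_same.
have [t tf tc] := red m m0 mA.
have := le_trans (smin t tf) tc.
have -> : (m *m w) 0 0 = cost s + e * (w j 0 - (row j A *m coords s *m w) 0 0).
  rewrite /m mulmxDl -scalemxAl mulmxBl -rowE [LHS]mxE; congr (_ + _).
  by rewrite [LHS]mxE; congr (_ * _); rewrite [LHS]mxE; congr (_ + _); rewrite mxE.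
by rewrite lerDl pmulr_rge0 // subr_ge0.
Qed.

(** Linear programming duality: the price [v i] of row [i] through its expansion in [s] equals [w i]
    on [s] and is strictly smaller off [s]. Equal total costs therefore forbid any weight off
    [s]. *)
Lemma cost_le_tight (w : 'cV[R]_N) s l : tight w s -> (forall i, 0 <= l 0 i) ->
  (l *m A *m coords s *m w) 0 0 <= (l *m w) 0 0 /\
  ((l *m A *m coords s *m w) 0 0 = (l *m w) 0 0 -> support l \subset s).
Proof.
move=> [bs ts] l0; pose v := A *m coords s *m w.
have vs i : i \in s -> v i 0 = w i 0.
  move=> si; have -> : v i 0 = (row i v) 0 0 by rewrite [RHS]mxE.
  by rewrite /v !row_mul coords_row // -rowE mxE.
have vn i : i \notin s -> v i 0 < w i 0.
  have -> : v i 0 = (row i v) 0 0 by rewrite [RHS]mxE.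
  by rewrite /v !row_mul; exact: ts.
have -> : l *m A *m coords s *m w = l *m v by rewrite /v !mulmxA.
have vw i : v i 0 <= w i 0 by case: (boolP (i \in s)) => [/vs->|/vn/ltW].
split; first by rewrite !mxE; apply: ler_sum => i _; rewrite ler_wpM2l.
rewrite !mxE => e; apply/fintype.subsetP => i; rewrite inE; apply: contraR => si.
have : \sum_j l 0 j * (w j 0 - v j 0) == 0.
  by under eq_bigr do rewrite mulrBr; rewrite sumrB e subrr.
rewrite psumr_eq0 => [|j _]; last by rewrite mulr_ge0 // subr_ge0.
move=> /allP /(_ i); rewrite mem_index_enum => /(_ isT) /=.
by rewrite mulf_eq0 subr_eq0 (gt_eqF (vn i si)) orbF.
Qed.

(** Both expansions of [y] have the least cost, so each is supported in the other basis. *)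
Lemma tight_unique (w : 'cV[R]_N) y s t : tight w s -> tight w t ->
  (forall i, i \in s -> 0 < (y *m coords s) 0 i) ->
  (forall i, i \in t -> 0 < (y *m coords t) 0 i) -> s = t.
Proof.
move=> ts tt ps pt.
have nn (u : {set 'I_N}) : (forall i, i \in u -> 0 < (y *m coords u) 0 i) -> forall i,
  0 <= (y *m coords u) 0 i.
  by move=> pu i; case: (boolP (i \in u)) => [/pu/ltW//|/coords_off->].
have yA (u : {set 'I_N}) : tight w u -> y *m coords u *m A = y.
  by move=> [[_ rf] _]; rewrite -mulmxA coordsK ?mulmx1.
have su (u : {set 'I_N}) : (forall i, i \in u -> 0 < (y *m coords u) 0 i) ->
  u \subset support (y *m coords u).
  by move=> pu; apply/fintype.subsetP => i /pu; rewrite inE; exact: lt0r_neq0.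
have [] := cost_le_tight ts (nn t pt); have [] := cost_le_tight tt (nn s ps).
rewrite !yA // => h1 e1 h2 e2.
have E : (y *m coords s *m w) 0 0 = (y *m coords t *m w) 0 0 by apply/eqP;
  rewrite eq_le h1 h2.
apply/eqP; rewrite finset.eqEsubset; apply/andP; split.
- exact: fintype.subset_trans (su s ps) (e1 (esym E)).
- exact: fintype.subset_trans (su t pt) (e2 E).
Qed.

Definition half_open_nonneg s (strict : 'I_N -> bool) x :=
  [forall i in s, if strict i then 0 < (x *m coords s) 0 i else 0 <= (x *m coords s) 0 i].

(** The push direction [q], and with it [strict], is fixed once; only the length [e] of the push
    depends on the point. The pushed point is generic, so it lies in the interior of exactly one
    tight cone. The nonstrict facet claimed for each cone bounds the box heights by [d] later. *)
Theorem cone_half_open_decomposition : (0 < D)%N -> row_full A ->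
  exists (T : {set {set 'I_N}}) (strict : {set 'I_N} -> 'I_N -> bool),
    (forall s, s \in T -> is_basis s /\ exists2 i, i \in s & ~~ strict s i) /\
    forall l, (forall i, 0 <= l 0 i) ->
      exists s, forall t, (t \in T) && half_open_nonneg t (strict t) (l *m A) = (t == s).
Proof.
move=> D0 rA.
(* Generic costs: no row outside a basis costs exactly as much as its expansion in that basis. *)
have [w [_ gw]] := @generic_positive_vector N ({set 'I_N} * 'I_N)%type
  (fun p => (delta_mx 0 p.2 - row p.2 A *m coords p.1)^T).
have {}gw s j : is_basis s -> j \notin s -> (row j A *m coords s *m w^T) 0 0 != w^T j 0.
  move=> bs js; pose g := delta_mx 0 j - row j A *m coords s.
  have gj : g^T != 0.
    apply/eqP => /matrixP /(_ j 0); rewrite mxE /g; have := coords_off (row j A) js.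
    by move: (row j A *m _) => u uj; rewrite !mxE uj !eqxx subr0 => /eqP; rewrite oner_eq0.
  have := gw (s, j) gj; rewrite -[w]trmxK -trmx_mul mxE trmxK mulmxBl mxE -rowE mxE.
  by rewrite [X in _ + X]mxE subr_eq0 eq_sym.
(* The linear forms on which [q] must not vanish unless they are zero: those cutting out the span of
   a subfamily, and the coordinates in a basis. *)
pose f (p : {set 'I_N} * ('I_D + 'I_N)) : 'cV[R]_D :=
  match p.2 with inl k => col k (cokermx (mask p.1 *m A)) | inr i => col i (coords p.1) end.
have [c [c0 gc]] := @generic_positive_vector N _ (fun p => A *m f p).
pose q := c *m A.
have qf p : f p != 0 -> (q *m f p) 0 0 != 0.
  move=> fp; rewrite /q -mulmxA; apply: gc; apply: contraNneq fp => Af.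
  have /row_fullP[B BA] := rA.
  by rewrite -[f p]mul1mx -BA -mulmxA Af mulmx0.
have coordE (x : 'rV[R]_D) s i : (x *m coords s) 0 i = (x *m f (s, inr i)) 0 0.
  by rewrite /f /= colE mulmxA -colE [RHS]mxE.
have coord_neq0 s i : is_basis s -> i \in s -> (q *m coords s) 0 i != 0.
  move=> bs si; rewrite coordE; apply: qf; apply/eqP => f0.
  have := coordE (row i A) s i; rewrite f0 mulmx0 coords_row // !mxE !eqxx => /eqP.
  by rewrite oner_eq0.
have gpert (x : 'rV[R]_D) e : (forall p, (q *m f p) 0 0 != 0 ->
  (x *m f p) 0 0 + e * (q *m f p) 0 0 != 0) ->
    generic (x + e *: q).
  move=> H s xs; rewrite -cokermx_eq0; apply/eqP/matrixP => i j; rewrite [RHS]mxE.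
  have [fj|fj] := eqVneq (f (s, inl j)) 0.
    by have := congr1 (fun u : 'cV[R]_D => u i 0) fj; rewrite /f /= !mxE.
  have := H _ (qf _ fj).
  have -> : (x *m f (s, inl j)) 0 0 + e * (q *m f (s,
    inl j)) 0 0 = ((x + e *: q) *m f (s, inl j)) 0 0.
    by rewrite mulmxDl -scalemxAl [RHS]mxE [X in _ = _ + X]mxE.
  by rewrite /f /= colE mulmxA xs mul0mx mxE eqxx.
(* Pushing in the direction [q] moves the facet [i] of the cone of [s] into the cone
   unless the coordinate of [q] is negative; that facet is then left out. *)
pose strict s i := (q *m coords s) 0 i < 0.
pose T := [set s | `[< tight w^T s >]]%SET.
exists T, strict; split.
  move=> s; rewrite inE => /asboolP [bs ts]; split => //.
  (* Otherwise all coordinates of [q] in [s], hence also its height, would be at most 0; but [q] is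
     a positive combination of rows of height 1. *)
  apply: contrapT => H.
  have qn i : (q *m coords s) 0 i <= 0.
    case: (boolP (i \in s)) => si; last by rewrite coords_off.
    apply: ltW; move/forall2NP: H => /(_ i)[] // /negP.
    by rewrite negbK.
  have : (q *m h) 0 0 <= 0.
    have -> : q = q *m coords s *m A by rewrite -mulmxA coordsK ?mulmx1 //; case: bs.
    rewrite -mulmxA hA mxE; apply: sumr_le0 => i _.
    by rewrite [X in _ * X]mxE mulr1.
  rewrite -mulmxA hA mxE leNgt => /negP; apply.
  have /card_gt0P[i si] : (0 < #|s|)%N by rewrite (card_basis bs).
  rewrite (bigD1 i) //= mxE mulr1 ltr_wpDr //.
  by apply: sumr_ge0 => k _; rewrite mxE mulr1 ltW.
move=> l l0; set x := l *m A.
have [e e0 He] := perturbation_sign (fun p => (x *m f p) 0 0) (fun p => (q *m f p) 0 0).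
pose y := x + e *: q.
have yC s i : (y *m coords s) 0 i = (x *m coords s) 0 i + e * (q *m coords s) 0 i.
  by rewrite mulmxDl -scalemxAl mxE [X in _ + X]mxE.
have gy : generic y by apply: gpert => p /He[].
have half s : is_basis s -> half_open_nonneg s (strict s) x <-> forall i,
  i \in s -> 0 < (y *m coords s) 0 i.
  move=> bs.
  have E i : i \in s -> (0 < (y *m coords s) 0 i) =
      (if strict s i then 0 < (x *m coords s) 0 i else 0 <= (x *m coords s) 0 i).
    move=> si; have := coord_neq0 s i bs si; rewrite yC /strict !coordE.
    by move=> /(He (s, inr i))[].
  by split => [/forall_inP|] H; last apply/forall_inP; move=> i si; have := H i si;
    rewrite E.
have [s ts ps] : exists2 s, tight w^T s & forall i, i \in s -> 0 < (y *m coords s) 0 i.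
  apply: (@tight_exists _ y (l + e *: c)) => // [i|].
    by rewrite !mxE addr_ge0 // mulr_ge0 // ltW.
  by rewrite mulmxDl -scalemxAl.
exists s => t; apply/andP/eqP => [[]|->]; last first.
  by split; [rewrite inE; exact/asboolP|apply/half => //; case: ts].
rewrite inE => /asboolP tt /half ht.
by apply: (tight_unique tt ts _ ps); apply: ht; case: tt.
Qed.

End ConeTriangulation.

(** * Lattice points of half-open simplicial cones *)

Lemma ZlatticeD {R : realType} {n : nat} (x y : 'rV[R]_n) :
  Zlattice x -> Zlattice y -> Zlattice (x + y).
Proof. by move=> hx hy i; rewrite mxE rpredD. Qed.

Lemma ZlatticeN {R : realType} {n : nat} (x : 'rV[R]_n) :
  Zlattice x -> Zlattice (- x).
Proof. by move=> hx i; rewrite mxE rpredN. Qed.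

Lemma Zlattice_mulmx {R : realType} {m n : nat} (x : 'rV[R]_m) (B : 'M[R]_(m, n)) :
  Zlattice x -> (forall i, Zlattice (row i B)) -> Zlattice (x *m B).
Proof.
move=> hx hB j; rewrite mxE rpred_sum // => i _; rewrite rpredM //.
by have := hB i j; rewrite mxE.
Qed.

(** The coordinates are bounded by [S], so the points lie in the grid of integers between [-K] and
    [K]. *)
Lemma finite_bounded_lattice {R : realType} {m n : nat} (A : 'M[R]_(m, n)) (M : R) :
  finite_set [set x : 'rV[R]_n | Zlattice x /\
    exists l : 'rV[R]_m, (forall i, 0 <= l 0 i <= M) /\ x = l *m A].
Proof.
pose S := \sum_(i < m) \sum_(j < n) M * `|A i j|.
pose K := Num.truncn S.
pose F (f : {ffun 'I_n -> 'I_(K + K).+1}) : 'rV[R]_n := \row_j ((f j)%:R - K%:R).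
apply: (@sub_finite_set _ _ (range F)); last exact: finite_image.
move=> x [hx [l [hl xl]]].
have xS j : `|x 0 j| <= S.
  rewrite xl mxE; apply: le_trans (ler_norm_sum _ _ _) _; apply: ler_sum => i _.
  have /andP[l0 lM] := hl i.
  rewrite normrM (ger0_norm l0); apply: le_trans (ler_wpM2r _ lM) _ => //.
  rewrite (bigD1 j) //= lerDl; apply: sumr_ge0 => k _.
  by rewrite mulr_ge0 // (le_trans l0).
have xz j : exists a : 'I_(K + K).+1, x 0 j = a%:R - K%:R.
  have /intrP[z xz] := hx j.
  have zK : (`|z| <= K)%N.
    rewrite /K truncn_ge_nat; last by apply: le_trans (xS j).
    by have := xS j; rewrite xz -intr_norm -abszE.
  have zK' : (`|(z + K%:Z)%R| < (K + K).+1)%N by lia.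
  exists (Ordinal zK') => /=; rewrite xz -[_%:R]/(_%:Z%:~R) abszE ger0_norm; last by lia.
  by rewrite rmorphD /= addrK.
have [f hf] := @fin_all_exists _ _ (fun j (a : 'I_(K + K).+1) => x 0 j = a%:R - K%:R) xz.
exists [ffun j => f j] => //.
by apply/rowP => j; rewrite mxE ffunE hf.
Qed.

Section SimplicialCone.
Context {R : realType} (d : nat) (B : 'M[R]_d.+1) (strict : 'I_d.+1 -> bool).
Context (Bint : forall i, Zlattice (row i B)) (B1 : forall i, B i 0 = 1)
  (Bunit : B \in unitmx).

Definition cone_slice (n : nat) : set 'rV[R]_d.+1 :=
  [set x | [/\ Zlattice x, x 0 0 = n%:R & forall i,
    if strict i then 0 < (x *m invmx B) 0 i else 0 <= (x *m invmx B) 0 i]].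

(** A strict coordinate ranges over (0, 1] instead of [0, 1), so that subtracting a natural number
    brings each coordinate of the half-open cone into its interval in exactly one way. *)
Definition fund_box : set 'rV[R]_d.+1 :=
  [set x | Zlattice x /\ forall i, if strict i then 0 < (x *m invmx B) 0 i <= 1
                                   else 0 <= (x *m invmx B) 0 i < 1].

Definition height_nat (x : 'rV[R]_d.+1) : nat := Num.truncn (x 0 0).

Definition box_heights : seq nat := [seq height_nat b | b <- fset_set fund_box].

(** Parts are ordinals up to [m] so that the known count of ordered partitions applies. *)
Definition compositions (m : nat) : seq 'rV[R]_d.+1 :=
  [seq \row_i (nat_of_ord (tnth (t : d.+1.-tuple 'I_m.+1) i))%:R | t <- enum [set t :
    d.+1.-tuple 'I_m.+1 | (\sum_(i <- t) (i : nat) == m)%N]%SET].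

Lemma size_compositions m : size (compositions m) = 'C(m + d, d).
Proof. by rewrite size_map -cardE card_ord_partitions addnC. Qed.

Lemma compositions_uniq m : uniq (compositions m).
Proof.
rewrite map_inj_uniq ?enum_uniq // => t u /rowP e.
apply: eq_from_tnth => i; have := e i; rewrite !mxE => /eqP.
by rewrite eqr_nat => /eqP; exact: val_inj.
Qed.

Lemma mem_compositions m (k : 'rV[R]_d.+1) :
  k \in compositions m <->
  exists2 f : 'I_d.+1 -> nat, k = \row_i (f i)%:R & (\sum_i f i = m)%N.
Proof.
split=> [/mapP[t]|[f -> fm]].
  rewrite mem_enum inE big_tuple => /eqP tm ->.
  by exists (fun i => nat_of_ord (tnth t i)).
have fle i : (f i < m.+1)%N by rewrite ltnS -fm (bigD1 i) //= leq_addr.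
apply/mapP; exists [tuple Ordinal (fle i) | i < d.+1].
  rewrite mem_enum inE big_tuple; apply/eqP; rewrite -[RHS]fm.
  by apply: eq_bigr => i _; rewrite tnth_mktuple.
by apply/rowP => i; rewrite !mxE tnth_mktuple.
Qed.

Lemma heightE (x : 'rV[R]_d.+1) : x 0 0 = \sum_i (x *m invmx B) 0 i.
Proof.
rewrite -[in LHS](mulmxKV Bunit x) mxE.
by apply: eq_bigr => i _; rewrite B1 mulr1.
Qed.

Lemma fund_box_finite : finite_set fund_box.
Proof.
apply: sub_finite_set (finite_bounded_lattice B 1) => x [hx xi]; split=> //.
exists (x *m invmx B); rewrite mulmxKV //; split=> // i.
by have := xi i; case: (strict i) => /andP[h1 h2]; apply/andP; split=> //; exact: ltW.
Qed.

Lemma cone_slice_finite n : finite_set (cone_slice n).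
Proof.
apply: sub_finite_set (finite_bounded_lattice B n%:R) => x [hx xn xi]; split=> //.
exists (x *m invmx B); rewrite mulmxKV //; split=> // i.
have c0 j : 0 <= (x *m invmx B) 0 j by have := xi j; case: (strict j) => // /ltW.
rewrite c0 -xn heightE (bigD1 i) //= lerDl; exact: sumr_ge0.
Qed.

Lemma fund_box_ge0 b i : fund_box b -> 0 <= (b *m invmx B) 0 i.
Proof. by move=> [_ /(_ i)]; case: (strict i) => /andP[h1 h2] //; exact: ltW. Qed.

Lemma fund_box_height b : fund_box b -> b 0 0 = (height_nat b)%:R.
Proof.
move=> hb; rewrite /height_nat; have b0 : 0 <= b 0 0 by rewrite heightE;
  apply: sumr_ge0 => i _; exact: fund_box_ge0.
by rewrite truncnK // natrEint b0 andbT; case: hb.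
Qed.

(** The height is the sum of [d + 1] coordinates, all at most 1 and the nonstrict one less than
    1. *)
Lemma box_heights_le : (exists i, ~~ strict i) -> all (fun j => (j <= d)%N) box_heights.
Proof.
move=> [i0 si0]; apply/allP => j /mapP[b + ->].
rewrite in_fset_set ?inE; last exact: fund_box_finite.
move=> hb; rewrite -ltnS -(@ltr_nat R) -fund_box_height // heightE.
rewrite -[X in _ < X%:R]card_ord -sumr_const (bigD1 i0) //= [ltRHS](bigD1 i0) //=.
case: hb => _ hb; apply: ltr_leD.
  by have := hb i0; rewrite (negbTE si0) => /andP[].
apply: ler_sum => i _; have := hb i; case: (strict i) => /andP[_] //; exact: ltW.
Qed.

Lemma round_coord c (b : bool) : (if b then 0 < c else 0 <= c) ->
  exists k : nat, if b then 0 < c - k%:R <= (1 : R) else 0 <= c - k%:R < 1.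
Proof.
case: b => c0.
  have /andP[h1 h2] := ceil_itv c; exists `|Num.ceil c - 1|%N.
  have cc : 0 < Num.ceil c by rewrite ceil_gt0.
  rewrite -[_%:R]/(_%:Z%:~R) abszE ger0_norm; last by lia.
  rewrite subr_gt0 h1 lerBlDr; rewrite rmorphB /=; lra.
exists (Num.truncn c); have /andP[h1 h2] := truncn_itv c0.
by rewrite subr_ge0 h1 ltrBlDr addrC -natr1 in h2 *.
Qed.

Lemma offset_inj (a a' : R) (f f' : nat) :
  a < a' + 1 -> a' < a + 1 -> a + f%:R = a' + f'%:R -> f = f'.
Proof.
move=> h1 h2 e; apply/eqP; rewrite eqn_leq -[(f <= f')%N]ltnS -[(f' <= f)%N]ltnS.
rewrite -!(ltr_nat R) -!natr1.
by apply/andP; split; lra.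
Qed.

Definition box_translations (n : nat) (b : 'rV[R]_d.+1) : seq 'rV[R]_d.+1 :=
  if (height_nat b <= n)%N then compositions (n - height_nat b) else [::].

Definition slice_points (n : nat) : seq 'rV[R]_d.+1 :=
  [seq b + k *m B | b <- fset_set fund_box, k <- box_translations n b].

Lemma slice_points_uniq n : uniq (slice_points n).
Proof.
apply: allpairs_uniq_dep => [|b _|].
- exact: fset_uniq.
- by rewrite /box_translations; case: ifP => // _; exact: compositions_uniq.
move=> _ _ /allpairsPdep[b [k [hb hk ->]]] /allpairsPdep[b' [k' [hb' hk' ->]]] /= e.
have {}hb : fund_box b by move: hb; rewrite in_fset_set ?inE //; exact: fund_box_finite.
have {}hb' : fund_box b' by move: hb'; rewrite in_fset_set ?inE //; exact: fund_box_finite.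
suff kk : k = k' by move: e; rewrite kk => /addIr ->.
move: hk hk'; rewrite /box_translations; case: ifP => // _ /mem_compositions[f kf _].
case: ifP => // _ /mem_compositions[f' kf' _].
apply/rowP => i; rewrite kf kf' !mxE; congr (_%:R).
have {}e := congr1 (fun z : 'rV[R]_d.+1 => (z *m invmx B) 0 i) e.
have cE (z l : 'rV[R]_d.+1) : ((z + l *m B) *m invmx B) 0 i = (z *m invmx B) 0 i + l 0 i.
  by rewrite mulmxDl mulmxK // mxE.
move: e; rewrite /= !cE kf kf' [X in _ + X]mxE [X in _ = _ + X]mxE.
case: hb => _ /(_ i); case: hb' => _ /(_ i).
move: ((b *m _) 0 i) ((b' *m _) 0 i) => a a' ha ha'; apply: offset_inj.
  by move: ha ha'; case: (strict i) => /andP[? ?] /andP[? ?]; lra.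
by move: ha ha'; case: (strict i) => /andP[? ?] /andP[? ?]; lra.
Qed.

Lemma mem_slice_points n x : x \in slice_points n <-> cone_slice n x.
Proof.
split.
  move=> /allpairsPdep[b [k [hb hk ->]]].
  have {}hb : fund_box b by move: hb; rewrite in_fset_set ?inE //; exact: fund_box_finite.
  move: hk; rewrite /box_translations; case: ifP => // tn /mem_compositions[f kf fs].
  split.
  - apply: ZlatticeD; first by case: hb.
    by apply: Zlattice_mulmx => // i; rewrite kf mxE natr_int.
  - rewrite heightE mulmxDl mulmxK //.
    under eq_bigr do rewrite mxE.
    rewrite big_split /= -heightE fund_box_height //.
    have -> : \sum_i k 0 i = \sum_i (f i)%:R by apply: eq_bigr => i _; rewrite kf mxE.
    by rewrite -natr_sum fs -natrD subnKC.
  - move=> i; rewrite mulmxDl mulmxK // mxE kf [X in _ + X]mxE.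
    by case: hb => _ /(_ i); case: (strict i) => /andP[h1 _]; rewrite ?ltr_wpDr // addr_ge0.
move=> [hx xn xi].
have [f hf] := @fin_all_exists _ _ _ (fun i => round_coord (xi i)).
pose k : 'rV[R]_d.+1 := \row_i (f i)%:R.
have hb : fund_box (x - k *m B).
  split.
    apply: ZlatticeD => //; apply: ZlatticeN.
    by apply: Zlattice_mulmx => // i; rewrite mxE natr_int.
  by move=> i; rewrite mulmxBl mulmxK // mxE [X in _ + X]mxE [X in _ - X]mxE.
have hn : (height_nat (x - k *m B) + \sum_i f i = n)%N.
  apply/eqP; rewrite -(@eqr_nat R) natrD -fund_box_height // -xn.
  rewrite [X in X + _]mxE [X in _ + X + _]mxE [(k *m B) 0 0]heightE mulmxK // natr_sum.
  have -> : \sum_i k 0 i = \sum_i (f i)%:R by apply: eq_bigr => i _; rewrite mxE.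
  by rewrite subrK.
apply/allpairsPdep; exists (x - k *m B), k; split.
- by rewrite in_fset_set ?inE //; exact: fund_box_finite.
- by rewrite /box_translations -{1}hn leq_addr; apply/mem_compositions; exists f => //;
  rewrite -hn addKn.
- by rewrite subrK.
Qed.

Theorem card_cone_slice n : (exists i, ~~ strict i) ->
  #|` fset_set (cone_slice n)|%fset = (\sum_(j <- box_heights) 'C(n + (d - j), d))%N.
Proof.
move=> /box_heights_le /allP hle.
have -> : #|` fset_set (cone_slice n)|%fset = size (slice_points n).
  apply: perm_size; apply: uniq_perm; [exact: fset_uniq|exact: slice_points_uniq|].
  move=> x; rewrite in_fset_set; last exact: cone_slice_finite.
  by apply/idP/idP; [rewrite inE => /mem_slice_points|move=> /mem_slice_points;
    rewrite inE].
rewrite size_allpairs_dep /box_translations sumnE big_map /box_heights big_map;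
  apply: eq_big_seq => b hb.
have jd : (height_nat b <= d)%N by apply: hle; apply/mapP; exists b.
case: leqP => jn; first by rewrite size_compositions; congr 'C(_, _); lia.
(* A box point higher than [n] has no translate in the slice, and [n + (d - j) < d] makes its
   binomial vanish. *)
by rewrite bin_small //; lia.
Qed.

End SimplicialCone.

(** * Polytopes, homogenization and vertices *)

Section ConvexHulls.
Context {R : realType} {d : nat}.
Implicit Types (s : seq 'rV[R]_d) (x y v : 'rV[R]_d) (C P : set 'rV[R]_d).

Lemma convex_setP C : @convex_set R 'rV[R]_d C <->
  forall x y (t : R), 0 <= t <= 1 -> C x -> C y -> C (t *: x + (1 - t) *: y).
Proof.
split=> [cC x y t /andP[t0 t1] Cx Cy|cC x y t].
  by have := cC x y (Itv01 t0 t1); rewrite !inE => /(_ Cx Cy).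
rewrite !inE => Cx Cy; apply: cC => //.
by apply/andP; split; [exact: ge0|exact: le1].
Qed.

Lemma convex_sum C n (p : 'I_n -> 'rV[R]_d) (l : 'I_n -> R) :
  @convex_set R 'rV[R]_d C -> (forall i, C (p i)) -> (forall i, 0 <= l i) ->
  \sum_i l i = 1 -> C (\sum_i l i *: p i).
Proof.
move=> /convex_setP cC; elim: n p l => [|n IH] p l hp l0 l1.
  by move: l1; rewrite big_ord0 => /eqP; rewrite eq_sym oner_eq0.
move: l1; rewrite !big_ord_recl => l1.
set S := \sum_(i < n) l (lift ord0 i) in l1.
have S0 : 0 <= S by apply: sumr_ge0.
have [Sz|Sn] := eqVneq S 0.
  have lz i : l (lift ord0 i) = 0.
    have /eqP := Sz; rewrite psumr_eq0 // => /allP /(_ i).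
    by rewrite mem_index_enum => /(_ isT) /eqP.
  have l01 : l ord0 = 1 by rewrite -l1 Sz addr0.
  rewrite l01 scale1r big1 ?addr0 // => i _; by rewrite lz scale0r.
have -> : \sum_(i < n) l (lift ord0 i) *: p (lift ord0 i) =
    (1 - l ord0) *: \sum_(i < n) (S^-1 * l (lift ord0 i)) *: p (lift ord0 i).
  have -> : 1 - l ord0 = S by rewrite -l1 addrC addKr.
  rewrite scaler_sumr; apply: eq_bigr => i _.
  by rewrite scalerA mulrA mulfV // mul1r.
apply: cC => //; first by rewrite l0 /= -l1 lerDl.
apply: IH => // [i|]; first by rewrite mulr_ge0 // invr_ge0.
by rewrite -mulr_sumr mulVf.
Qed.

(* Homogenization: the cone over [P] at height 1 is spanned by these vectors. *)
Definition hom (t : R) x : 'rV[R]_d.+1 := \row_j oapp (x 0) t (unlift ord0 j).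
Definition dehom (z : 'rV[R]_d.+1) : 'rV[R]_d := \row_j z 0 (lift ord0 j).
Definition hom_mx s : 'M[R]_(size s, d.+1) := \matrix_(i < size s) hom 1 s`_i.
Definition in_cone m (A : 'M[R]_(m, d.+1)) (z : 'rV[R]_d.+1) :=
  exists l : 'rV[R]_m, (forall i, 0 <= l 0 i) /\ z = l *m A.

Lemma hom0E t x : (hom t x) 0 0 = t.
Proof. by rewrite mxE unlift_none. Qed.

Lemma hom_liftE t x i : (hom t x) 0 (lift ord0 i) = x 0 i.
Proof. by rewrite mxE liftK. Qed.

Lemma homK t : cancel (hom t) dehom.
Proof. by move=> x; apply/rowP => i; rewrite mxE hom_liftE. Qed.

Lemma dehomK (z : 'rV[R]_d.+1) : hom (z 0 0) (dehom z) = z.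
Proof.
apply/rowP => j; rewrite mxE; case: (unliftP ord0 j) => [i ->|->] //=.
by rewrite mxE.
Qed.

Lemma hom_inj t : injective (hom t).
Proof. exact: can_inj (homK t). Qed.

Lemma homD t t' x y : hom t x + hom t' y = hom (t + t') (x + y).
Proof. by apply/rowP => j; rewrite !mxE; case: (unlift ord0 j) => [i|] //=;
  rewrite mxE. Qed.

Lemma homZ a t x : a *: hom t x = hom (a * t) (a *: x).
Proof. by apply/rowP => j; rewrite !mxE; case: (unlift ord0 j) => [i|] //=;
  rewrite mxE. Qed.

Lemma hom00 : hom 0 0 = 0.
Proof. by apply/rowP => j; rewrite !mxE; case: (unlift ord0 j) => [i|] //=;
  rewrite mxE. Qed.

Lemma hom_sum n (l : 'I_n -> R) (t : 'I_n -> R) (p : 'I_n -> 'rV[R]_d) :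
  \sum_i l i *: hom (t i) (p i) = hom (\sum_i l i * t i) (\sum_i l i *: p i).
Proof.
elim: n l t p => [|n IH] l t p; first by rewrite !big_ord0 hom00.
by rewrite !big_ord_recl IH homZ homD.
Qed.

Lemma hom_mx_mul s (l : 'rV[R]_(size s)) :
  l *m hom_mx s = hom (\sum_i l 0 i) (\sum_i l 0 i *: s`_i).
Proof.
rewrite mulmx_sum_row -(eq_bigr _ (fun i _ => mulr1 (l 0 i))) -hom_sum.
by apply: eq_bigr => i _; rewrite rowK.
Qed.

Lemma hom_mx_height s : hom_mx s *m (delta_mx 0 0 : 'cV[R]_d.+1) = const_mx 1.
Proof. by apply/colP => i; rewrite -colE !mxE unlift_none. Qed.

Lemma conv_hullP s x : conv_hull [set` s] x <-> in_cone (hom_mx s) (hom 1 x).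
Proof.
split; last first.
  move=> [l [l0]]; rewrite hom_mx_mul => e.
  have e1 : \sum_i l 0 i = 1 by have := congr1 (fun z : 'rV[R]_d.+1 => z 0 0) e;
    rewrite !hom0E.
  move: e; rewrite e1 => /hom_inj -> C [cC sC].
  by apply: convex_sum => // i; apply: sC; exact: mem_nth.
apply: (@smallest_sub _ _ _ [set x | in_cone (hom_mx s) (hom 1 x)]).
  apply/convex_setP => {}x y t /andP[t0 t1] [l [l0 hl]] [m [m0 hm]].
  exists (t *: l + (1 - t) *: m); split.
    by move=> i; rewrite !mxE addr_ge0 // mulr_ge0 // subr_ge0.
  by rewrite mulmxDl -!scalemxAl -hl -hm !homZ homD !mulr1; congr (hom _ _); ring.
move=> {}x /= xs; have ix : (index x s < size s)%N by rewrite index_mem.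
exists (delta_mx 0 (Ordinal ix)); split=> [i|]; first by rewrite mxE; case: (_ && _).
by rewrite -rowE rowK nth_index.
Qed.

Lemma conv_hull_convex C : @convex_set R 'rV[R]_d (conv_hull C).
Proof.
apply/convex_setP => x y t t01 hx hy A [cA CA].
by move/convex_setP: (cA); apply => //; [exact: hx|exact: hy].
Qed.

Lemma conv_hull_sub s s' : {subset s <= s'} -> conv_hull [set` s] `<=` conv_hull [set` s'].
Proof. move=> ss'; apply: smallest_sub; first exact: conv_hull_convex.
by move=> x /= /ss' xs'; apply: sub_gen_smallest. Qed.

(** For [a = 1] nothing is said of [u], since the hull of [s] may then be empty. *)
Lemma conv_hull_cons v s x : conv_hull [set` v :: s] x ->
  exists2 a, 0 <= a <= 1 & exists2 u, x = a *: v + (1 - a) *: u &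
    a != 1 -> conv_hull [set` s] u.
Proof.
move=> /conv_hullP[l [l0]]; rewrite hom_mx_mul !big_ord_recl /= => e.
have l1 : l 0 ord0 + \sum_(i < size s) l 0 (lift ord0 i) = 1.
  by have := congr1 (fun z : 'rV[R]_d.+1 => z 0 0) e; rewrite !hom0E.
move: e; rewrite l1 => /hom_inj ->; set a := l 0 ord0.
have S1 : \sum_(i < size s) l 0 (lift ord0 i) = 1 - a by rewrite -l1 addrC addKr.
have S0 : 0 <= 1 - a by rewrite -S1; apply: sumr_ge0.
exists a; first by rewrite l0 -subr_ge0.
exists (\sum_(i < size s) ((1 - a)^-1 * l 0 (lift ord0 i)) *: s`_i) => [|a1].
  congr (_ + _); rewrite scaler_sumr; apply: eq_bigr => i _; rewrite scalerA mulrA.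
  have [a1|a1] := eqVneq (1 - a) 0; last by rewrite mulfV // mul1r.
  have /eqP := S1; rewrite a1 psumr_eq0 // => /allP /(_ i).
  by rewrite mem_index_enum => /(_ isT) /eqP ->; rewrite !mulr0.
have a1' : 1 - a != 0 by rewrite subr_eq0 eq_sym.
apply: convex_sum => [|i|i|].
- exact: conv_hull_convex.
- by apply: sub_gen_smallest; exact: mem_nth.
- by rewrite mulr_ge0 // invr_ge0.
- by rewrite -mulr_sumr S1 mulVf.
Qed.

(** Suppose [v] is a proper combination of [a v + (1 - a) u] and [b v + (1 - b) w]. Solving for [v]
    makes it a combination of [u] and [w], of total weight [c] before normalization, unless [c = 0],
    that is [a = b = 1], and then both points are [v]. *)
Lemma vertex_or_redundant v s : ~ vertex (conv_hull [set` v :: s]) v ->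
  conv_hull [set` v :: s] = conv_hull [set` s].
Proof.
move=> nv; suff vs : conv_hull [set` s] v.
  apply/seteqP; split; last by apply: conv_hull_sub => x xs; rewrite inE xs orbT.
  apply: smallest_sub; first exact: conv_hull_convex.
  move=> x /=; rewrite inE => /orP[/eqP-> //|xs]; exact: sub_gen_smallest.
apply: contrapT => ns; apply: nv; split.
  by apply: sub_gen_smallest; rewrite /= inE eqxx.
move=> x y t /conv_hull_cons[a /andP[a0 a1] [u ->
  hu]] /conv_hull_cons[b /andP[b0 b1] [w -> hw]].
move=> /andP[t0 t1] e.
have t1' : 0 < 1 - t by rewrite subr_gt0.
pose c := t * (1 - a) + (1 - t) * (1 - b).
have a1' : 0 <= 1 - a by rewrite subr_ge0.
have b1' : 0 <= 1 - b by rewrite subr_ge0.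
have [c0|c0] := eqVneq c 0.
  move: c0 => /eqP; rewrite paddr_eq0 ?mulr_ge0 // ?(ltW t0) ?(ltW t1') //.
  rewrite !mulf_eq0 (gt_eqF t0) (gt_eqF t1') /= => /andP[/eqP aa /eqP bb].
  have -> : a = 1 by lra.
  have -> : b = 1 by lra.
  by rewrite subrr scale1r !scale0r addr0.
case: ns.
have ee : c *: v = (t * (1 - a)) *: u + ((1 - t) * (1 - b)) *: w.
  apply/rowP => i; have := congr1 (fun z : 'rV[R]_d => z 0 i) e; rewrite !mxE /c; lra.
have [a1e|a1n] := eqVneq a 1.
  have cE : c = (1 - t) * (1 - b) by rewrite /c a1e subrr mulr0 add0r.
  have -> : v = w by apply: (scalerI c0); rewrite ee cE a1e subrr mulr0 scale0r add0r.
  by apply: hw; apply: contraNneq c0 => be; rewrite cE be subrr mulr0.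
have [b1e|b1n] := eqVneq b 1.
  have cE : c = t * (1 - a) by rewrite /c b1e subrr mulr0 addr0.
  have -> : v = u by apply: (scalerI c0); rewrite ee cE b1e subrr mulr0 scale0r addr0.
  exact: hu.
have cC := @conv_hull_convex [set` s]; move/convex_setP in cC.
have cp : 0 < c by rewrite lt0r c0 addr_ge0 // mulr_ge0 // ltW.
have -> : v = (t * (1 - a) / c) *: u + (1 - t * (1 - a) / c) *: w.
  apply: (scalerI c0); rewrite ee scalerDr !scalerA mulrCA mulfV // mulr1;
    congr (_ + _ *: _).
  by rewrite [RHS]mulrBr mulr1 mulrCA mulfV // mulr1 /c; ring.
apply: cC; [|exact: hu|exact: hw].
rewrite divr_ge0 ?mulr_ge0 ?(ltW t0) ?(ltW cp) //= ler_pdivrMr // mul1r /c lerDl.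
by rewrite mulr_ge0 // ltW.
Qed.

(** Generators that are not vertices are discarded one at a time; those that remain are vertices,
    hence lattice points. *)
Lemma integral_polytope_generators P : integral_polytope P ->
  exists2 s : seq 'rV[R]_d, P = conv_hull [set` s] & forall v, v \in s -> Zlattice v.
Proof.
move=> [[s Ps] vP]; have [n] := ubnP (size s); elim: n s Ps => // n IH s Ps.
rewrite ltnS => sn.
have [H|] := pselect (forall v, v \in s -> vertex P v).
  by exists s => // v /H /vP.
move=> /existsNP[v /not_implyP[vs nv]].
have E : [set` s] = [set` v :: rem v s].
  by apply/seteqP; split => x /=; rewrite (perm_mem (perm_to_rem vs)).
apply: (IH (rem v s)); last first.
  by rewrite size_rem //; apply: leq_trans sn; case: (s) vs.
by rewrite Ps E vertex_or_redundant // -E -Ps.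
Qed.

Lemma affine_hull_full P : has_dim P d -> affine_hull P = setT.
Proof.
move=> [x0 [W [dW ->]]].
have -> : W = fullv by apply/eqP; rewrite eqEdim subvf dW dimvf /= /dim /= mul1n.
apply/seteqP; split => // x _; exists (x - x0); last by rewrite addrC subrK.
by rewrite /= memvf.
Qed.

Lemma has_dim_full P : affine_hull P = setT -> has_dim P d.
Proof.
move=> PT; exists 0, fullv; split; first by rewrite dimvf /dim /= mul1n.
by rewrite PT; apply/seteqP; split => // x _; exists x; rewrite ?add0r //= memvf.
Qed.

(** Vectors of height 1 span the whole space; conversely, expanding such a vector in rows of height
    1 forces the coefficients to sum to 1. *)
Lemma affine_hull_hom_mx s : affine_hull (conv_hull [set` s]) =
  setT <-> row_full (hom_mx s).
Proof.
split => [aT|/row_fullP[B BA]].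
  have key x : (hom 1 x <= hom_mx s)%MS.
    have : affine_hull (conv_hull [set` s]) x by rewrite aT.
    move=> [n [p [l [hp l1 ->]]]].
    have -> : hom 1 (\sum_(i < n) l i *: p i) = \sum_(i < n) l i *: hom 1 (p i).
      by rewrite hom_sum; congr (hom _ _); under eq_bigr do rewrite mulr1.
    apply: summx_sub => i _; apply: scalemx_sub.
    by have /conv_hullP[m [_ ->]] := hp i; rewrite submxMl.
  rewrite -sub1mx; apply/row_subP => i.
  have -> : row i 1%:M = ((row i 1%:M : 'rV[R]_d.+1) 0 0 - 1) *: hom 1 0 + hom 1 (dehom
    (row i 1%:M)).
    by rewrite homZ homD mulr1 scaler0 add0r subrK dehomK.
  by rewrite addmx_sub // scalemx_sub.
apply/seteqP; split => // x _.
have : hom 1 x *m B *m hom_mx s = hom 1 x by rewrite -mulmxA BA mulmx1.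
set l := _ *m B; rewrite hom_mx_mul => e.
have l1 : \sum_i l 0 i = 1.
  by have := congr1 (fun z : 'rV[R]_d.+1 => z 0 0) e; rewrite !hom0E.
exists (size s), (fun i => s`_i), (fun i => l 0 i); split => //.
  by move=> i; apply: sub_gen_smallest; exact: mem_nth.
by apply: (@hom_inj 1); rewrite -e l1.
Qed.

(** A convex set stays convex when an extreme point is removed; if [v] were not in [s], the hull
    without [v] would still contain [s]. *)
Lemma vertex_conv_hull s v : vertex (conv_hull [set` s]) v -> v \in s.
Proof.
move=> [vP vE]; apply: contrapT => /negP vs.
suff : (conv_hull [set` s] `\ v) v by move=> [_]; apply.
move: v vP vE vs => v vP vE vs; move: (vP); apply: smallest_sub.
  apply/convex_setP => x y t /andP[t0 t1] [Px xv] [Py yv].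
  split.
    by move/convex_setP: (@conv_hull_convex [set` s]); apply => //; rewrite t0.
  move: t0; rewrite le_eqVlt => /orP[/eqP <-|t0].
    by rewrite scale0r add0r subr0 scale1r.
  move: t1; rewrite le_eqVlt => /orP[/eqP ->|t1].
    by rewrite subrr scale0r addr0 scale1r.
  move=> /esym e; have t01 : 0 < t < 1 by rewrite t0.
  by have [] := vE x y t Px Py t01 e.
move=> x /= xs; split; first exact: sub_gen_smallest.
by move=> xv; rewrite -xv xs in vs.
Qed.

End ConvexHulls.

(** * The Ehrhart series and its h*-vector *)

Section EhrhartSeries.
Context {R : realType} {d : nat}.
Implicit Types (s : seq 'rV[R]_d).

Definition cone_lattice m (A : 'M[R]_(m, d.+1)) (n : nat) : set 'rV[R]_d.+1 :=
  [set z | [/\ Zlattice z, z 0 0 = n%:R & in_cone A z]].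

Lemma Zlattice_hom (n : nat) (x : 'rV[R]_d) : Zlattice x -> Zlattice (hom n%:R x).
Proof.
by move=> hx j; rewrite mxE; case: (unlift ord0 j) => [i|] /=; [exact: hx|exact: natr_int].
Qed.

Lemma dehom_lattice (z : 'rV[R]_d.+1) : Zlattice z -> Zlattice (dehom z).
Proof. by move=> hz j; rewrite mxE. Qed.

Lemma cone_lattice_finite m (A : 'M[R]_(m, d.+1)) n : (forall i, A i 0 = 1) ->
  finite_set (cone_lattice A n).
Proof.
move=> A1; apply: sub_finite_set (finite_bounded_lattice A n%:R) => z [hz zn [l [l0 zl]]].
split=> //; exists l; split => // i; rewrite l0 -zn zl mxE.
rewrite (bigD1 i) //= A1 mulr1 lerDl; apply: sumr_ge0 => j _.
by rewrite A1 mulr1.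
Qed.

Lemma hom_mx1 s i : hom_mx s i 0 = 1.
Proof. by rewrite !mxE unlift_none. Qed.

Lemma cone_latticeE s n : (0 < n)%N ->
  dilate n (conv_hull [set` s]) `&` @Zlattice R d = dehom @` (cone_lattice (hom_mx s) n).
Proof.
move=> n0; have nn : n%:R != 0 :> R by rewrite pnatr_eq0 -lt0n.
apply/seteqP; split => [y [[x /conv_hullP[l [l0 xl]] <-] hy]|y [z [hz zn [l [l0 zl]]] <-]].
  exists (hom n%:R (n%:R *: x)); last exact: homK.
  split; [exact: Zlattice_hom|exact: hom0E|].
  exists (n%:R *: l); split; first by move=> i; rewrite mxE mulr_ge0.
  by rewrite -scalemxAl -xl homZ mulr1.
split; last exact: dehom_lattice.
exists (n%:R^-1 *: dehom z); last by rewrite scalerA mulfV // scale1r.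
apply/conv_hullP; exists (n%:R^-1 *: l); split.
  by move=> i; rewrite mxE mulr_ge0 // invr_ge0.
have zE := dehomK z; rewrite zn in zE.
by rewrite -scalemxAl -zl -[in RHS]zE homZ mulVf.
Qed.

Lemma dehom_inj n m (A : 'M[R]_(m, d.+1)) : {in cone_lattice A n &, injective dehom}.
Proof.
move=> z z'; rewrite !inE => -[_ zn _] [_ zn' _] e.
by rewrite -(dehomK z) -(dehomK z') zn zn' e.
Qed.

Lemma dilate_lattice_finite s n : (0 < n)%N ->
  finite_set (dilate n (conv_hull [set` s]) `&` @Zlattice R d).
Proof.
move=> n0; rewrite cone_latticeE //; apply: finite_image.
by apply: cone_lattice_finite; exact: hom_mx1.
Qed.

Lemma lattice_count_cone s n : (0 < n)%N ->
  lattice_count (conv_hull [set` s]) n = #|` fset_set (cone_lattice (hom_mx s) n)|%fset.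
Proof.
move=> n0; rewrite /lattice_count cone_latticeE //.
have fC : finite_set (cone_lattice (hom_mx s) n) by apply: cone_lattice_finite;
  exact: hom_mx1.
rewrite fset_set_image // card_in_imfset //= => z z'.
rewrite !in_fset_set //; exact: dehom_inj.
Qed.

Lemma card_sum_parts (T : choiceType) (I : finType) (P : pred I) (A : set T) (B : I ->
  set T) :
  finite_set A -> (forall i, P i -> finite_set (B i)) ->
  (forall x, A x -> exists i, forall j, (P j && `[< B j x >]) = (j == i)) ->
  (forall i, P i -> B i `<=` A) ->
  #|` fset_set A|%fset = (\sum_(i | P i) #|` fset_set (B i)|%fset)%N.
Proof.
move=> fA fB AB BA.
transitivity (\sum_(x <- fset_set A) \sum_(i | P i) `[< B i x >])%N.
  rewrite -sum1_size; apply: eq_big_seq => x.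
  rewrite in_fset_set // inE => /AB[i hi].
  have := hi i; rewrite eqxx => /andP[Pi Bi]; rewrite (bigD1 i) //= Bi.
  rewrite big1 // => j /andP[Pj ji]; have := hi j.
  by rewrite Pj (negbTE ji) /= => ->.
rewrite exchange_big /=; apply: eq_bigr => i Pi.
rewrite -big_mkcond /= sum1_count -size_filter; apply: perm_size.
apply: uniq_perm; [by rewrite filter_uniq // fset_uniq|exact: fset_uniq|move=> x].
rewrite mem_filter !in_fset_set //; last exact: fB.
apply/andP/idP => [[/asboolP]|]; rewrite !inE //.
by move=> Bx; split; [by []|exact: (BA i)].
Qed.

(** Turns a basis given as an index set into an invertible square matrix, as required for simplicial
    cones. *)
Definition basis_enumeration m (A : 'M[R]_(m,
  d.+1)) (t : {set 'I_m}) (g : 'I_d.+1 -> 'I_m) :=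
  [/\ forall i, g i \in t, forall j, j \in t -> exists i, g i = j, rowsub g A \in unitmx &
    forall (x : 'rV[R]_d.+1) i, (x *m invmx (rowsub g A)) 0 i = (x *m coords A t) 0 (g i)].

Lemma basis_enum m (A : 'M[R]_(m, d.+1)) (t : {set 'I_m}) : is_basis A t ->
  exists g, basis_enumeration A t g.
Proof.
move=> bt; have ct := card_basis bt.
pose g (i : 'I_d.+1) := enum_val (cast_ord (esym ct) i).
have gt i : g i \in t by exact: enum_valP.
have gK j : j \in t -> exists i, g i = j.
  move=> jt; exists (cast_ord ct (enum_rank_in jt j)).
  by rewrite /g cast_ordK enum_rankK_in.
have ginj : injective g by move=> i j /enum_val_inj /cast_ord_inj.
have BC : rowsub g A *m colsub g (coords A t) = 1%:M.
  apply/matrixP => i j; rewrite mxE [RHS]mxE.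
  have := congr1 (fun z : 'rV[R]_m => z 0 (g j)) (coords_row bt (gt i)).
  rewrite /= [X in _ = X]mxE mxE eqxx /= (inj_eq ginj) eq_sym => <-.
  by apply: eq_bigr => k _; rewrite !mxE.
have [Bu _] := mulmx1_unit BC.
have BI : invmx (rowsub g A) = colsub g (coords A t).
  by rewrite -[LHS]mulmx1 -BC mulKmx.
exists g; split=> // x i; rewrite BI !mxE.
by apply: eq_bigr => k _; rewrite mxE.
Qed.

(** The entry [d] is kept apart because the bound by [M_min] holds only for entries below [d]. *)
Theorem ehrhart_series s : (forall v, v \in s -> Zlattice v) -> row_full (hom_mx s) ->
  exists2 I : seq nat, all (fun i => (i < d)%N) I &
    forall n, (0 < n)%N -> lattice_count (conv_hull [set` s]) n =
      (\sum_(i <- d :: I) 'C(n + i, d))%N.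
Proof.
move=> sZ rf; set A := hom_mx s.
have [T [strict [hT dec]]] := cone_half_open_decomposition (hom_mx_height s) (ltn0Sn d) rf.
have AZ i : Zlattice (row i A).
  rewrite rowK; apply: (@Zlattice_hom 1); apply: sZ; exact: mem_nth.
(* Supplies a default index for the sets outside [T]. *)
have s0 : (0 < size s)%N.
  by rewrite lt0n; apply: contraTneq rf => s0;
    rewrite /row_full ltn_eqF // ltnS (leq_trans (rank_leq_row _)) // s0.
have [t|g hg] := @choice _ _ (fun t g => t \in T -> basis_enumeration A t g).
  have [tT|tT] := boolP (t \in T); last by exists (fun=> Ordinal s0).
  by have [/basis_enum[g hg] _] := hT t tT; exists g.
pose B t := rowsub (g t) A; pose st t i := strict t (g t i).
have BZ t i : Zlattice (row i (B t)) by rewrite row_rowsub; exact: AZ.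
have B1 t i : B t i 0 = 1 by rewrite mxE; exact: hom_mx1.
have nonstrict t : t \in T -> exists i, ~~ st t i.
  move=> tT; have [_ [j jt sj]] := hT t tT; have [_ gK _ _] := hg t tT.
  by have [i gi] := gK j jt; exists i; rewrite /st gi.
have half t z : t \in T -> half_open_nonneg A t (strict t) z <->
    forall i, if st t i then 0 < (z *m invmx (B t)) 0 i else 0 <= (z *m invmx (B t)) 0 i.
  move=> tT; have [gt gK _ gC] := hg t tT; split.
    by move=> /forall_inP H i; rewrite gC; exact: H.
  by move=> H; apply/forall_inP => j jt; have [i <-] := gK j jt; have := H i; rewrite gC.
have fC n : finite_set (cone_lattice A n) by apply: cone_lattice_finite; exact: hom_mx1.
pose H0 := flatten [seq box_heights (B t) (st t) | t <- enum T].
have key n : #|` fset_set (cone_lattice A n)|%fset = (\sum_(j <- H0) 'C(n + (d - j), d))%N.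
  rewrite (@card_sum_parts _ _ (mem T) _ (fun t => cone_slice (B t) (st t) n)) //.
  - rewrite /H0 big_flatten big_map big_enum /=; apply: eq_bigr => t tT.
    have [_ _ Bu _] := hg t tT.
    by rewrite card_cone_slice //; exact: nonstrict.
  - by move=> t tT; have [_ _ Bu _] := hg t tT; apply: cone_slice_finite => //; exact: B1.
  - move=> z [hz zn [l [l0 zl]]]; have [t0 ht0] := dec l l0.
    exists t0 => t; rewrite -ht0 -zl; apply: andb_id2l => tT.
    apply/asboolP/idP => [[_ _ /half]|/half]; first exact.
    by move=> H; split => //; exact: H.
  - move=> t tT z [hz zn hi]; split => //; exists (z *m coords A t).
    have [[ind rft] _] := hT t tT; rewrite -mulmxA coordsK // mulmx1; split => // i.
    have [gt gK _ gC] := hg t tT.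
    have [it|it] := boolP (i \in t); last by rewrite coords_off.
    have [j <-] := gK i it; rewrite -gC; have := hi j; case: (st t j) => //; exact: ltW.
have H0d : {in H0, forall j, (j <= d)%N}.
  move=> j /flattenP[_ /mapP[t + ->]]; rewrite mem_enum => tT.
  have [_ _ Bu _] := hg t tT.
  by have /allP := box_heights_le (B1 t) Bu (nonstrict t tT); apply.
have C0 : cone_lattice A 0 = [set 0].
  apply/seteqP; split => [z [hz z0 [l [l0 zl]]]|z ->] /=; last first.
    split; [by move=> i; rewrite mxE|by rewrite mxE|].
    by exists 0; rewrite mul0mx; split => // i; rewrite mxE.
  rewrite zl; suff -> : l = 0 by rewrite mul0mx.
  apply/rowP => i; rewrite mxE; apply/eqP.
  have : \sum_i l 0 i == 0.
    rewrite -[X in _ == X]z0 zl mxE; apply/eqP; apply: eq_bigr => k _.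
    by rewrite hom_mx1 mulr1.
  by rewrite psumr_eq0 // => /allP /(_ i); rewrite mem_index_enum => /(_ isT).
(* Evaluate at [n = 0]: the cone has one lattice point of height 0, and ['C(d - j, d)] is 1 for
   [j = 0] and 0 for the other heights. *)
have cnt : count (pred1 0%N) H0 = 1%N.
  rewrite -(cardfs1 (0 : 'rV[R]_d.+1)) -fset_set1 -C0 key -sum1_count big_mkcond /=.
  apply: eq_big_seq => j /H0d jd; case: eqP => [->|/eqP jn].
    by rewrite add0n subn0 binn.
  by rewrite bin_small //; lia.
exists [seq (d - j)%N | j <- H0 & j != 0%N].
  by apply/allP => _ /mapP[j + ->]; rewrite mem_filter => /andP[j0 /H0d jd]; lia.
move=> n n0; rewrite lattice_count_cone // key big_cons big_map big_filter.
rewrite (bigID (pred1 0%N)) /=; congr addn.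
transitivity (\sum_(j <- H0 | j == 0%N) 'C(n + d, d))%N.
  by apply: eq_bigr => j /eqP ->; rewrite subn0.
by rewrite big_const_seq cnt /= addn0.
Qed.

End EhrhartSeries.

(** * Volume as the leading Ehrhart coefficient *)

Section Volume.
Context {R : realType} {d : nat}.
Implicit Types (s : seq 'rV[R]_d) (P : set 'rV[R]_d).

(** The hull of [v :: s] is a continuous image of the product of [0, 1] with the hull of [s],
    together with [v] itself in case [s] is empty. *)
Lemma conv_hull_compact s : compact (conv_hull [set` s]).
Proof.
elim: s => [|v s IH].
  have -> : conv_hull [set` ([::] : seq 'rV[R]_d)] = set0; last exact: compact0.
  apply/seteqP; split => // x /conv_hullP[l [_ e]].
  have := hom0E 1 x; rewrite e mxE big_ord0 => /eqP.
  by rewrite eq_sym oner_eq0.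
pose f (p : R^o * 'rV[R]_d) : 'rV[R]_d := p.1 *: v + (1 - p.1) *: p.2.
have -> : conv_hull [set` v :: s] =
    [set v] `|` f @` (`[0%R, 1%R]%classic `*` conv_hull [set` s]).
  apply/seteqP; split => x.
    move=> /conv_hull_cons[a a01 [u -> hu]].
    have [->|a1] := eqVneq a 1; first by left; rewrite scale1r subrr scale0r addr0.
    have ia : `[0%R, 1%R]%classic a by rewrite /= in_itv.
    by right; exists (a, u) => //; split; [exact: ia|exact: hu].
  have vP : conv_hull [set` v :: s] v by apply: sub_gen_smallest; rewrite /= inE eqxx.
  case=> [->//|[[a u] [/= a01 us] <-]]; rewrite /f /=.
  move/convex_setP: (@conv_hull_convex _ _ [set` v :: s]); apply => //.
  by apply: conv_hull_sub us => y; rewrite inE => ->; rewrite orbT.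
apply: compactU; first exact: compact_set1.
apply: continuous_compact; last by apply: compact_setX => //; exact: segment_compact.
apply: continuous_subspaceT => p; apply: cvgD.
  by apply: cvgZr_tmp; exact: cvg_fst.
apply: cvgZ; last exact: cvg_snd.
by apply: cvgB; [exact: cvg_cst|exact: cvg_fst].
Qed.

(** In each direction, list [truncn (be i - al i) + 1] consecutive integers from the ceiling of
    [al i] on. The last may exceed [be i]; only the upper bound on the number matters. *)
Lemma lattice_points_in_box (al be : 'I_d -> R) : (forall i, al i <= be i) ->
  exists2 pts : seq 'rV[R]_d,
    (forall x : 'rV[R]_d, Zlattice x -> (forall i, al i <= x 0 i <= be i) -> x \in pts) &
    (size pts)%:R <= \prod_i (be i - al i + 1).
Proof.
move=> ab; pose m i := (Num.truncn (be i - al i)).+1.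
pose F (f : {dffun forall i : 'I_d, 'I_(m i)}) : 'rV[R]_d :=
  \row_i (Num.ceil (al i) + (f i : nat)%:Z)%:~R.
exists [seq F f | f <- enum {: {dffun forall i : 'I_d, 'I_(m i)}}]; last first.
  rewrite size_map -cardE card_dep_ffun foldrE big_image /= natr_prod.
  apply: ler_prod => i _; rewrite card_ord ler0n /= /m -natr1 lerD2r.
  by rewrite truncn_le subr_ge0.
move=> x hx xb.
have hk i : exists k : 'I_(m i), x 0 i = (Num.ceil (al i) + (k : nat)%:Z)%:~R.
  have /intrP[z xz] := hx i; have /andP[h1 h2] := xb i.
  have zc : Num.ceil (al i) <= z by rewrite ceil_le_int -xz.
  have km : (`|z - Num.ceil (al i)| < m i)%N.
    rewrite /m ltnS truncn_ge_nat ?subr_ge0 //.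
    rewrite -[_%:R]/(_%:Z%:~R) abszE ger0_norm ?subr_ge0 // rmorphB /= -xz.
    have /andP[_ h3] := ceil_itv (al i); lra.
  exists (Ordinal km) => /=; rewrite xz abszE ger0_norm ?subr_ge0 //.
  by rewrite subrKC.
pose f : {dffun forall i : 'I_d, 'I_(m i)} := [ffun i => projT1 (cid (hk i))].
apply/mapP; exists f; first by rewrite mem_enum.
by apply/rowP => i; rewrite mxE ffunE; exact: (projT2 (cid (hk i))).
Qed.

(* Compare [L n] with the number of lattice points in the boxes dilated by [n]. *)
Lemma coef_lead_le_cover P (L : {poly R}) (K : choiceType) (F : {fset K}) (a b : K ->
  'rV[R]_d) :
  (size L <= d.+1)%N ->
  (forall n, (0 < n)%N -> L.[n%:R] = (lattice_count P n)%:R) ->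
  (forall n, (0 < n)%N -> finite_set (dilate n P `&` @Zlattice R d)) ->
  (forall k i, a k 0 i <= b k 0 i) ->
  (forall x, P x -> exists2 k, k \in F & box (a k) (b k) x) ->
  L`_d <= \sum_(k <- F) \prod_i (b k 0 i - a k 0 i).
Proof.
move=> sL LP fP ab cov.
pose Q := \sum_(k <- F) \prod_(i < d) ((b k 0 i - a k 0 i) *: 'X + 1%:P) - L.
suff : 0 <= Q`_d.
  rewrite /Q coefB subr_ge0 coef_sum => /le_trans; apply.
  apply: ler_sum => k _.
  by have [_ ->] := @prod_linear R d (fun i => b k 0 i - a k 0 i) (fun=> 1).
apply: poly_nonneg_coef.
  apply: leq_trans (size_polyD _ _) _; rewrite size_polyN geq_max sL andbT.
  apply: leq_trans (size_sum _ _ _) _; apply/bigmax_leqP_seq => k _ _.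
  by have [] := @prod_linear R d (fun i => b k 0 i - a k 0 i) (fun=> 1).
move=> n n0; rewrite /Q hornerD hornerN LP // subr_ge0 horner_sum.
have [pts hpts] := @choice K (seq 'rV[R]_d) (fun k pts =>
    (forall x : 'rV[R]_d, Zlattice x -> (forall i,
      n%:R * a k 0 i <= x 0 i <= n%:R * b k 0 i) -> x \in pts) /\
    (size pts)%:R <= \prod_i (n%:R * b k 0 i - n%:R * a k 0 i + 1)) (fun k =>
  match @lattice_points_in_box (fun i => n%:R * a k 0 i) (fun i => n%:R * b k 0 i)
    (fun i => ler_wpM2l (ler0n _ _) (ab k i)) with ex_intro2 pts h1 h2 => ex_intro _ pts
      (conj h1 h2) end).
apply: (@le_trans _ _ (size (flatten [seq pts k | k <- F]))%:R).
  rewrite ler_nat /lattice_count; apply: uniq_leq_size; first exact: fset_uniq.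
  move=> y; rewrite in_fset_set; last exact: fP.
  rewrite inE => -[[x Px xy] hy]; have [k kF xk] := cov x Px.
  apply/flattenP; exists (pts k); first exact: map_f.
  have [h _] := hpts k; apply: h => // i; rewrite -xy mxE.
  by have /andP[h1 h2] := xk i; rewrite !ler_wpM2l.
rewrite size_flatten sumnE !big_map natr_sum; apply: ler_sum => k _.
have [_ h] := hpts k; apply: le_trans h _; rewrite horner_prod.
by apply: ler_prod => i _; rewrite !hornerE /= -mulrBr addr_ge0 ?mulr_ge0 ?subr_ge0 //=
  mulrC.
Qed.

(** By compactness, finitely many boxes of a countable cover suffice once each is thickened to
    contain an open neighbourhood of the original. Box [k] is allowed to gain volume [e / 2^(k+1)],
    in total at most [e]. *)
Lemma lebesgue_outer_ge s (L : {poly R}) :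
  (size L <= d.+1)%N ->
  (forall n, (0 < n)%N -> L.[n%:R] = (lattice_count (conv_hull [set` s]) n)%:R) ->
  ((L`_d)%:E <= lebesgue_outer (conv_hull [set` s]))%E.
Proof.
move=> sL LP; apply: le_ereal_inf_tmp => _ [a [b [ab cov ->]]].
apply/lee_addgt0Pr => e e0.
pose v k := \prod_i (b k ord0 i - a k ord0 i).
have v0 k : 0 <= v k by apply: prodr_ge0 => i _; rewrite subr_ge0.
have [k|h hh] := @choice nat R (fun k h => 0 < h /\
    \prod_i (b k ord0 i + h - (a k ord0 i - h)) <= v k + e / (2 ^ k.+1)%:R).
  have e2 : 0 < e / (2 ^ k.+1)%:R by rewrite divr_gt0 // ltr0n expn_gt0.
  have [h h0] := poly_small_increase
    (\prod_(i < d) (2 *: 'X + (b k ord0 i - a k ord0 i)%:P)) e2.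
  rewrite !horner_prod => hp; exists h; split => //.
  rewrite (eq_bigr (fun i => (2 *: 'X + (b k ord0 i - a k ord0 i)%:P).[h])).
    apply: le_trans hp _; rewrite lerD2r /v.
    by apply: ler_prod => i _; rewrite !hornerE ?mulr0 ?add0r lexx andbT subr_ge0 ab.
  by move=> i _; rewrite !hornerE /=; ring.
pose a' k := a k - const_mx (h k); pose b' k := b k + const_mx (h k).
pose U k := \bigcup_(x in box (a k) (b k)) ball x (h k).
have UB k : U k `<=` box (a' k) (b' k).
  move=> y [x xb] [h0 xy] i; have := xy ord0 i; have := xb i.
  rewrite /ball /= ltr_distlC !mxE => /andP[h1 h2] /andP[h3 h4].
  by apply/andP; split; lra.
have : cover_compact (conv_hull [set` s]).
  rewrite -compact_cover; exact: conv_hull_compact.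
move=> /(_ nat setT U) [].
- by move=> k _; apply: bigcup_open => x _; exact: ball_open.
- move=> x /cov [k _ xk]; exists k => //; exists x => //.
  by apply: ballxx; have [] := hh k.
move=> F _ FU.
have hF : L`_d <= \sum_(k <- F) (v k + e / (2 ^ k.+1)%:R).
  apply: (le_trans (@coef_lead_le_cover (conv_hull [set` s]) L _ F a' b' sL LP _ _ _)).
  - by move=> n n0; exact: dilate_lattice_finite.
  - move=> k i; rewrite !mxE; have [h0 _] := hh k; have := ab k i; lra.
  - by move=> x /FU[k kF /UB]; exists k.
  apply: ler_sum => k _; have [_ hk] := hh k; apply: le_trans hk.
  by under eq_bigr do rewrite !mxE.
apply: le_trans (@epsilon_trick R (fun k => (v k)%:E) e xpredT _ (ltW e0)); last first.
  by move=> n; rewrite lee_fin.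
apply: (@le_trans _ _ (\sum_(k <- F) ((v k)%:E + (e / (2 ^ k.+1)%:R)%:E))%E).
  by rewrite -lee_fin in hF; apply: le_trans hF _; rewrite -sumEFin.
apply: (@lee_sum_fset_lim R (fun k => ((v k)%:E + (e / (2 ^ k.+1)%:R)%:E)%E) F xpredT).
move=> k _; rewrite -EFinD lee_fin addr_ge0 // divr_ge0 // ltW //.
Qed.

(* A large multiple of the sum of the generators lies so deep inside the cone that
   subtracting any vector of the unit cube at height 0 stays in the cone. *)
Lemma deep_lattice_point s : (forall v, v \in s -> Zlattice v) -> row_full (hom_mx s) ->
  exists c : nat, exists2 y : 'rV[R]_d, Zlattice y &
    forall u : 'rV[R]_d, (forall i, 0 <= u 0 i <= 1) ->
      in_cone (hom_mx s) (hom c%:R (y - u)).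
Proof.
move=> sZ /row_fullP[C CA]; pose A := hom_mx s.
(* Row [j] of [C] expands the [j]-th unit vector in the generators, so [K] exceeds every coefficient
   of a vector of the unit cube. *)
pose K := (Num.truncn (\sum_j \sum_i `|C j i|)).+1.
have KC : \sum_j \sum_i `|C j i| < K%:R by exact: truncnS_gt.
pose k : 'rV[R]_(size s) := const_mx K%:R.
have kh : (k *m A) 0 0 = (K * size s)%N%:R.
  rewrite mxE; under eq_bigr do rewrite hom_mx1 mulr1 mxE.
  by rewrite sumr_const card_ord natrM mulr_natr.
exists (K * size s)%N, (dehom (k *m A)).
  apply: dehom_lattice; apply: Zlattice_mulmx => i.
    by rewrite mxE natr_int.
  rewrite rowK; apply: (@Zlattice_hom _ _ 1); apply: sZ; exact: mem_nth.
move=> u u01; exists (k - hom 0 u *m C); split; last first.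
  rewrite mulmxBl -[_ *m C *m _]mulmxA CA mulmx1.
  have -> : - hom 0 u = hom 0 (- u) by rewrite -scaleN1r homZ mulr0 scaleN1r.
  by rewrite -[X in _ = X + _]dehomK homD addr0 kh.
move=> i; rewrite mxE [k 0 i]mxE [X in _ + X]mxE subr_ge0; apply: le_trans (ltW KC).
rewrite mxE; apply: ler_sum => j _.
have hj : `|hom 0 u 0 j| <= 1.
  rewrite mxE; case: (unlift ord0 j) => [l|] /=; last by rewrite normr0.
  by have /andP[u0 u1] := u01 l; rewrite ger0_norm.
apply: le_trans (ler_norm _) _; rewrite normrM.
apply: le_trans (ler_wpM2r _ hj) _ => //; rewrite mul1r.
by rewrite (bigD1 i) //= lerDl; apply: sumr_ge0.
Qed.

(* Cover by cubes of side [1/n]; a corner, translated by a deep lattice point of height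
   [c], is a lattice point of the dilate by [n + c]. *)
Lemma lebesgue_outer_le_lattice_count s : (0 < d)%N -> (forall v, v \in s -> Zlattice v) ->
  row_full (hom_mx s) ->
  exists c : nat, forall n, (0 < n)%N -> (lebesgue_outer (conv_hull [set` s]) <=
    ((lattice_count (conv_hull [set` s]) (n + c))%:R / n%:R ^+ d)%:E)%E.
Proof.
move=> d0 sZ rf; have [c [y yZ hy]] := deep_lattice_point sZ rf.
exists c => n n0; have nn : 0 < n%:R :> R by rewrite ltr0n.
set P := conv_hull _.
have nc0 : (0 < n + c)%N by rewrite addn_gt0 n0.
pose D := fset_set (dilate (n + c) P `&` @Zlattice R d).
pose zs : seq 'rV[R]_d := [seq z - y | z <- D].
have szs : size zs = lattice_count P (n + c) by rewrite size_map.
(* Beyond the list the boxes shrink to a point, of volume 0 because [0 < d]. *)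
pose a k : 'rV[R]_d := if (k < size zs)%N then n%:R^-1 *: zs`_k else 0.
pose b k : 'rV[R]_d := if (k < size zs)%N then n%:R^-1 *: zs`_k + const_mx n%:R^-1 else 0.
have ab k i : a k ord0 i <= b k ord0 i.
  by rewrite /a /b; case: ifP => // _; rewrite [X in _ <= X]mxE [X in _ + X]mxE lerDl
    invr_ge0.
have abE k : \prod_(i < d) (b k ord0 i - a k ord0 i) =
  if (k < size zs)%N then n%:R ^- d else 0.
  rewrite /a /b; case: ifP => _.
    under eq_bigr do rewrite [X in X - _]mxE [X in _ + X - _]mxE addrAC subrr add0r.
    by rewrite prodr_const card_ord exprVn.
  under eq_bigr do rewrite subrr.
  by rewrite prodr_const card_ord expr0n gtn_eqF.
apply: ereal_inf_lbound; exists a, b; split => //.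
  move=> p Pp.
  pose z : 'rV[R]_d := \row_i (Num.floor (n%:R * p 0 i))%:~R.
  have zi i : z 0 i <= n%:R * p 0 i < z 0 i + 1.
    by have := floor_itv (n%:R * p 0 i); rewrite mxE rmorphD.
  have zD : z + y \in D.
    rewrite in_fset_set; last exact: dilate_lattice_finite.
    rewrite inE cone_latticeE //; exists (hom (n + c)%:R (z + y)); last exact: homK.
    have zyZ : Zlattice (z + y) by apply: ZlatticeD => // i; rewrite mxE intr_int.
    split; [exact: Zlattice_hom|exact: hom0E|].
    have [l [l0 lp]] := (conv_hullP s p).1 Pp.
    (* The rounding error lies in the unit cube; adding [n] times the point over [p] gives [z + y]
       at height [n + c]. *)
    have [|m [m0 mu]] := hy (n%:R *: p - z).
      by move=> i; have /andP[h1 h2] := zi i; rewrite !mxE in h1 h2 *; apply/andP; split;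
        lra.
    exists (n%:R *: l + m); split.
      by move=> i; rewrite !mxE addr_ge0 // mulr_ge0.
    rewrite mulmxDl -scalemxAl -lp -mu homZ homD mulr1 natrD; congr (hom _ _).
    by apply/rowP => i; rewrite !mxE; ring.
  have zzs : z \in zs by rewrite -[z](addrK y); apply: map_f.
  exists (index z zs) => // i.
  rewrite /a /b index_mem zzs nth_index //.
  have /andP[h1 h2] := zi i; move: h1 h2; set t := z 0 i => h1 h2.
  rewrite mxE [X in _ <= _ <= X]mxE [X in X + _]mxE [X in _ + X]mxE -/t.
  rewrite -[X in _ <= _ <= _ + X]mulr1 -mulrDr ler_pdivrMl // h1 /=.
  by rewrite ler_pdivlMl // ltW.
rewrite (@nneseries_split _ _ 0 (size zs)) => [|k _]; last by rewrite lee_fin abE;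
  case: ifP.
rewrite [X in (_ + X)%E]eseries0 => [|k]; last by rewrite add0n abE ltnNge => ->.
rewrite adde0 add0n sumEFin; congr (_%:E).
rewrite (eq_big_nat _ _ (F2 := fun=> n%:R ^- d)) => [|k /andP[_ kz]];
  last by rewrite abE kz.
by rewrite sumr_const_nat subn0 szs mulr_natl.
Qed.

(** The shift by [c] does not change the coefficient of degree [d], so comparing L(n + c) with v n^d
    for all positive [n] bounds the measure [v] above by this coefficient. *)
Theorem lebesgue_outer_conv_hull s (L : {poly R}) : (0 < d)%N ->
  (forall v, v \in s -> Zlattice v) -> row_full (hom_mx s) -> (size L <= d.+1)%N ->
  (forall n, (0 < n)%N -> L.[n%:R] = (lattice_count (conv_hull [set` s]) n)%:R) ->
  vol (conv_hull [set` s]) = L`_d.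
Proof.
move=> d0 sZ rf sL LP; have := lebesgue_outer_ge sL LP.
have [c] := lebesgue_outer_le_lattice_count d0 sZ rf.
rewrite /vol; case: (lebesgue_outer _) => [v| |] hc hL; last 2 first.
- by have := hc 1%N isT.
- by [].
apply/eqP; rewrite /= eq_le andbC -lee_fin hL /= -subr_ge0.
pose Q := (L \Po ('X + c%:R%:P)) - v *: 'X^d.
have sX : size ('X + c%:R%:P : {poly R}) = 2%N by rewrite size_XaddC.
have sLc := size_comp_poly2 L sX.
have Lc : (L \Po ('X + c%:R%:P))`_d = L`_d.
  have [sLd|dL] := leqP (size L) d; first by rewrite !nth_default ?sLc.
  have sE : size L = d.+1 by apply/eqP; rewrite eqn_leq sL.
  have := lead_coef_comp L (q := 'X + c%:R%:P); rewrite sX => /(_ isT).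
  by rewrite lead_coefXaddC expr1n mulr1 !lead_coefE sLc sE.
suff : 0 <= Q`_d.
  by rewrite /Q coefB coefZ coefXn eqxx mulr1 Lc.
apply: poly_nonneg_coef.
  apply: leq_trans (size_polyD _ _) _; rewrite size_polyN geq_max; apply/andP; split.
    by rewrite sLc.
  by apply: leq_trans (size_scale_leq _ _) _; rewrite size_polyXn.
move=> n n0; rewrite /Q !hornerE horner_comp !hornerE -natrD LP ?addn_gt0 ?n0 //.
by rewrite subr_ge0 -ler_pdivlMr ?exprn_gt0 ?ltr0n // -lee_fin; exact: hc.
Qed.

End Volume.

(** * Ehrhart coefficients from the h*-vector, and the minimum M_{r,d} *)

Section LowerBound.
Context {R : realType} {d : nat}.
Implicit Types (s : seq 'rV[R]_d) (P : set 'rV[R]_d).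

Lemma ehrhart_polyE P (I : seq nat) :
  (forall n, (0 < n)%N -> lattice_count P n = (\sum_(i <- I) 'C(n + i, d))%N) ->
  ehrhart_poly P = binomial_sum_poly R d I.
Proof.
move=> hP; apply: poly_eq_nat => n n0; rewrite binomial_sum_polyE -hP //.
rewrite /ehrhart_poly; set S := (X in xget _ X).
have : S (xget 0 S) by apply: xgetPex; exists (binomial_sum_poly R d I) => k k0;
  rewrite binomial_sum_polyE hP.
by apply.
Qed.

(* [d :: I] encodes the h*-vector: each term [i] is one unit of its entry of degree
   [d - i]. *)
Lemma ehrhart_coef_vol s (I : seq nat) (r : nat) : (0 < d)%N ->
  (forall v, v \in s -> Zlattice v) -> row_full (hom_mx s) ->
  (forall n, (0 < n)%N -> lattice_count (conv_hull [set` s]) n =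
    (\sum_(i <- d :: I) 'C(n + i, d))%N) ->
  ehrhart_coef r (conv_hull [set` s]) =
    (d`!%:R)^-1 * ((Ccoef d r d%:Z)%:~R + (\sum_(i <- I) Ccoef d r i%:Z)%:~R) /\
  d`!%:R * vol (conv_hull [set` s]) - 1 = (size I)%:R.
Proof.
move=> d0 sZ rf hI; split.
  by rewrite /ehrhart_coef (ehrhart_polyE hI) coef_binomial_sum_poly big_cons rmorphD.
have [sL lL] := binomial_sum_poly_lead R d (d :: I).
rewrite (lebesgue_outer_conv_hull d0 sZ rf sL) => [|n n0].
  by rewrite lL mulrCA mulfV ?mulr1 /= -?natr1 ?addrK // pnatr_eq0 -lt0n fact_gt0.
by rewrite binomial_sum_polyE hI.
Qed.

End LowerBound.

(** Only two indices fall outside the range of the minimum: [0], which is compared with [1], and its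
    mirror image [d - 1]. *)
Lemma M_min_le_all (d r i : nat) : (3 <= d)%N -> (r < d)%N -> ~~ odd (d - r) -> (i < d)%N ->
  M_min r d <= Ccoef d r i%:Z.
Proof.
move=> d3 rd odr id.
have M0 : M_min r d <= Ccoef d r 0.
  apply: (@le_trans _ _ (Ccoef d r 1)); last by apply: Ccoef_pred_le => //; lia.
  by apply: (@M_min_le r d 1); lia.
have [->|i0] := eqVneq i 0%N; first exact: M0.
have [id1|id1] := eqVneq i d.-1; last by apply: M_min_le; lia.
have -> : i%:Z = d%:Z - 1 - 0 by lia.
by rewrite Ccoef_reflect 1?ltnW // -signr_odd (negbTE odr) mul1r.
Qed.

(** Of a minimizing index and its mirror image, one gives [p.*2 < d], which leaves room for the
    coordinates of the extremal simplex. *)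
Lemma M_min_attained_half (d r : nat) : (3 <= d)%N -> (r < d)%N -> ~~ odd (d - r) ->
  exists p : nat, [/\ (p.*2 < d)%N, (p.+1 < d)%N & M_min r d = Ccoef d r (d - p.+1)%N%:Z].
Proof.
move=> d3 rd odr; have [i id ->] := M_min_attained r d3.
have [h|h] := leqP ((d - i).*2) d.+1.
  exists (d - i).-1; split; [lia|lia|congr (Ccoef d r _); lia].
exists i; split; [lia|lia|].
have -> : (d - i.+1)%N%:Z = d%:Z - 1 - i%:Z by lia.
by rewrite Ccoef_reflect 1?ltnW // -signr_odd (negbTE odr) mul1r.
Qed.

(** * A simplex attaining equality *)

Section ExtremalSimplex.
Context {R : realType} (d p m : nat) (pd : (p.*2 < d)%N) (m0 : (0 < m)%N).

(* Modulo the lattice, the box points are the multiples of [1/m] times a vector with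
   [p + 1] coordinates [1] and [p + 1] coordinates [-1]: the apex coordinates provide [p]
   of each, the apex itself a [1] and the origin the remaining [-1]. Thus all nonzero
   multiples have height [p + 1]. *)
Definition apex_coord (t : 'I_d) : R :=
  if lift ord0 t == ord_max then m%:R
  else if (t < p)%N then 1 else if (t < p.*2)%N then -1 else 0.

(** Index 0 is the origin, the last index the apex, and the others are unit vectors. *)
Definition simplex_vertex (i : 'I_d.+1) : 'rV[R]_d :=
  \row_t (if i == ord_max then apex_coord t else (i == lift ord0 t)%:R).

Definition simplex_mx : 'M[R]_d.+1 := \matrix_i hom 1 (simplex_vertex i).

Lemma simplex_mx1 i : simplex_mx i 0 = 1.
Proof. by rewrite !mxE unlift_none. Qed.

Lemma simplex_mx_mul0 (c : 'rV[R]_d.+1) : (c *m simplex_mx) 0 0 = \sum_i c 0 i.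
Proof. by rewrite mxE; apply: eq_bigr => i _; rewrite !mxE unlift_none mulr1. Qed.

Lemma simplex_mx_mul (c : 'rV[R]_d.+1) t : (c *m simplex_mx) 0 (lift ord0 t) =
  (if lift ord0 t == ord_max then 0 else c 0 (lift ord0 t)) + c 0 ord_max * apex_coord t.
Proof.
rewrite mxE (bigD1 ord_max) //= addrC; congr (_ + _); last first.
  by rewrite !mxE liftK /= mxE eqxx.
have E i : i != ord_max -> c 0 i * simplex_mx i (lift ord0 t) =
  c 0 i * (i == lift ord0 t)%:R.
  by move=> im; rewrite !mxE liftK /= mxE (negbTE im).
rewrite (eq_bigr _ E); case: ifP => [/eqP tm|/negbT tm].
  by apply: big1 => i im; rewrite tm (negbTE im) mulr0.
rewrite (bigD1 (lift ord0 t)) //= eqxx mulr1 big1 ?addr0 // => i /andP[_ it].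
by rewrite (negbTE it) mulr0.
Qed.

Lemma last_index : exists t : 'I_d, lift ord0 t = ord_max.
Proof.
have d0 : (d.-1 < d)%N by lia.
by exists (Ordinal d0); apply: val_inj => /=; rewrite /bump /=; lia.
Qed.

Lemma simplex_mx_unit : simplex_mx \in unitmx.
Proof.
rewrite -row_free_unit; apply: inj_row_free => c cB.
have [t tm] := last_index.
have cm : c 0 ord_max = 0.
  have := simplex_mx_mul c t; rewrite cB mxE tm eqxx add0r /apex_coord tm eqxx => /esym/eqP.
  by rewrite mulf_eq0 pnatr_eq0 -[m == 0%N]negbK -lt0n m0 orbF => /eqP.
have cl u : c 0 (lift ord0 u) = 0.
  have := simplex_mx_mul c u; rewrite cB mxE cm mul0r addr0.
  by case: eqP => [-> //|_ ->].
have c0 : c 0 ord0 = 0.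
  have := simplex_mx_mul0 c; rewrite cB mxE big_ord_recl big1 ?addr0 => [->//|u _];
    exact: cl.
by apply/rowP => i; rewrite mxE; case: (unliftP ord0 i) => [u ->|->].
Qed.

Lemma step_sum (n a b : nat) (x y : R) : (a + b <= n)%N ->
  \sum_(i < n) (if (i < a)%N then x else if (i < a + b)%N then y else 0) =
    a%:R * x + b%:R * y.
Proof.
move=> abn; rewrite -(big_mkord xpredT (fun i => if (i < a)%N then x else if (i < a +
  b)%N then y else 0)).
rewrite (@big_cat_nat _ _ _ a) //=; last by rewrite (leq_trans _ abn) ?leq_addr.
rewrite (@big_cat_nat _ _ _ (a + b) a) ?leq_addr //=.
rewrite [X in X + _](eq_big_nat _ _ (F2 := fun=> x)) => [|i /andP[_ ->] //].
rewrite [X in _ + (X + _)](eq_big_nat _ _ (F2 := fun=> y)) => [|i /andP[ai ->]];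
  last by rewrite ltnNge ai.
rewrite [X in _ + (_ + X)](eq_big_nat _ _ (F2 := fun=> 0)) => [|i /andP[ai _]]; last first.
  by rewrite !ltnNge ai (leq_trans _ ai) ?leq_addr.
by rewrite !sumr_const_nat subn0 addKn mul0rn addr0 !mulr_natl.
Qed.

(** For [l < m], [th] is the fractional part of [l / m] and [ph - th] that of [- l / m]; the factor
    [ph] covers [l = 0]. *)
Definition box_coord (l : nat) (i : 'I_d.+1) : R :=
  let th := l%:R / m%:R in let ph := (0 < l)%N%:R in
  if i == ord_max then th
  else if (i <= p)%N then ph - th else if (i <= p.*2)%N then th else 0.

Definition box_point (l : nat) : 'rV[R]_d.+1 := (\row_i box_coord l i) *m simplex_mx.

Lemma box_point_height l : (box_point l) 0 0 = ((0 < l)%N * p.+1)%N%:R.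
Proof.
rewrite simplex_mx_mul0; under eq_bigr do rewrite mxE.
rewrite big_ord_recr /= [X in _ + X]/box_coord eqxx.
set th := _ / _; set ph : R := (0 < l)%N%:R.
rewrite (eq_bigr (fun i : 'I_d => if (i < p.+1)%N then ph - th else
    if (i < p.+1 + p)%N then th else 0)) => [|i _]; last first.
  rewrite /box_coord -(inj_eq val_inj) /= ltn_eqF // -/th -/ph ltnS.
  by rewrite -addnn addSn ltnS.
rewrite step_sum; last by rewrite addSn addnn.
rewrite natrM -/ph -natr1; ring.
Qed.

Lemma box_point_coord l t : (box_point l) 0 (lift ord0 t) =
  (if lift ord0 t == ord_max then l else ((0 < l) && (t < p))%N : nat)%:R.
Proof.
rewrite simplex_mx_mul !mxE /apex_coord /box_coord eqxx.
case: ifP => tm; first by rewrite add0r divfK // pnatr_eq0 -lt0n.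
rewrite tm lift0; case: (ltnP t p) => tp; first by rewrite mulr1 subrK andbT.
by rewrite andbF; case: ifP => _; rewrite ?mulrN1 ?subrr ?mulr0 ?addr0.
Qed.

Lemma box_coord_itv l i : (l < m)%N -> 0 <= box_coord l i < 1.
Proof.
move=> lm; have mp : 0 < m%:R :> R by rewrite ltr0n.
have th0 : 0 <= l%:R / m%:R :> R by rewrite divr_ge0.
have th1 : l%:R / m%:R < 1 :> R by rewrite ltr_pdivrMr // mul1r ltr_nat.
rewrite /box_coord; case: ifP => _; first by rewrite th0 th1.
case: ifP => _; last by case: ifP => _; rewrite ?th0 ?th1 // lexx ltr01.
case: l lm th0 th1 => [|l] lm th0 th1 /=; first by rewrite mul0r subr0 lexx ltr01.
have : 0 < l.+1%:R / m%:R :> R by rewrite divr_gt0 ?ltr0n.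
by move=> ?; apply/andP; split; lra.
Qed.

Lemma int_lt1_eq0 (x : R) : x \is a Num.int -> -1 < x < 1 -> x = 0.
Proof.
move=> /intrP[z ->]; rewrite -[-1]/((-1)%:~R) -[1]/(1%:~R) !ltr_int => z1.
by have -> : z = 0 by lia.
Qed.

Lemma box_point_lattice l : Zlattice (box_point l).
Proof.
move=> i; case: (unliftP ord0 i) => [t ->|->]; first by rewrite box_point_coord natr_int.
by rewrite box_point_height natr_int.
Qed.

(** The last coordinate of [z] is [m] times its apex coefficient, which determines [l]. The
    difference [x] to the candidate has entries strictly between -1 and 1: the apex entry vanishes,
    so integrality of the coordinates kills the middle entries, and integrality of the height kills
    the first. *)
Lemma mem_fund_box z : fund_box simplex_mx (fun=> false) z <->
  exists l : 'I_m, z = box_point l.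
Proof.
split; last first.
  move=> [l ->]; split; first exact: box_point_lattice.
  by move=> i; rewrite mulmxK ?simplex_mx_unit // mxE box_coord_itv.
move=> [hz hc]; set c := z *m _ in hc; have [t tm] := last_index.
have zc : z = c *m simplex_mx by rewrite mulmxKV // simplex_mx_unit.
have mp : 0 < m%:R :> R by rewrite ltr0n.
have zt : z 0 (lift ord0 t) = c 0 ord_max * m%:R.
  by rewrite {1}zc simplex_mx_mul /apex_coord tm eqxx add0r.
have [cm0 cm1] := andP (hc ord_max).
have /natrP[l zl] : z 0 (lift ord0 t) \is a Num.nat.
  by rewrite natrEint hz zt mulr_ge0 // ltW.
have lm : (l < m)%N by rewrite -(ltr_nat R) -zl zt gtr_pMl.
exists (Ordinal lm) => //=; rewrite zc /box_point; congr (_ *m _).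
pose x : 'rV[R]_d.+1 := c - \row_i box_coord l i.
have xZ : Zlattice (x *m simplex_mx).
  rewrite mulmxBl -zc; apply: ZlatticeD => //; apply: ZlatticeN; exact: box_point_lattice.
have xb i : -1 < x 0 i < 1.
  rewrite !mxE; have /andP[h1 h2] := hc i; have /andP[h3 h4] := box_coord_itv i lm.
  by rewrite /c mxE in h1 h2; apply/andP; split; lra.
have xm : x 0 ord_max = 0.
  rewrite /x mxE [X in _ + X]mxE [X in _ - X]mxE /box_coord eqxx -zl zt mulfK ?subrr //.
  by rewrite gt_eqF.
have xl u : x 0 (lift ord0 u) = 0.
  have [->//|um] := eqVneq (lift ord0 u) ord_max.
  apply: int_lt1_eq0 => //.
  by have := xZ (lift ord0 u); rewrite simplex_mx_mul (negbTE um) xm mul0r addr0.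
have x0 : x 0 ord0 = 0.
  apply: int_lt1_eq0 => //.
  by have := xZ ord0; rewrite simplex_mx_mul0 big_ord_recl big1 ?addr0 // => u _; exact: xl.
apply/eqP; rewrite -subr_eq0 -/x; apply/eqP/rowP => i; rewrite [RHS]mxE.
by case: (unliftP ord0 i) => [u ->|->].
Qed.

Definition simplex_vertices : seq 'rV[R]_d := [seq simplex_vertex i | i <- enum 'I_d.+1].

Lemma simplex_vertices_lattice v : v \in simplex_vertices -> Zlattice v.
Proof.
move=> /mapP[i _ ->] t; rewrite mxE; case: ifP => _; last exact: natr_int.
rewrite /apex_coord; case: ifP => _; first exact: natr_int.
by case: ifP => _; last case: ifP => _; rewrite ?rpredN ?rpred1 ?rpred0.
Qed.

Lemma size_simplex_vertices : size simplex_vertices = d.+1.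
Proof. by rewrite size_map size_enum_ord. Qed.

Lemma hom_mx_simplex (i : 'I_(size simplex_vertices)) :
  row i (hom_mx simplex_vertices) = row (cast_ord size_simplex_vertices i) simplex_mx.
Proof.
rewrite !rowK (nth_map ord0) ?size_enum_ord //; last by rewrite -size_simplex_vertices.
by congr (hom 1 (simplex_vertex _)); apply: val_inj;
  rewrite /= nth_enum_ord // -size_simplex_vertices.
Qed.

Lemma mulmx_hom_simplex (l : 'rV[R]_(size simplex_vertices)) :
  l *m hom_mx simplex_vertices = castmx (erefl 1%N, size_simplex_vertices) l *m simplex_mx.
Proof.
rewrite !mulmx_sum_row (reindex (cast_ord size_simplex_vertices)) /=; last first.
  by exists (cast_ord (esym size_simplex_vertices)) => i _; rewrite ?cast_ordK ?cast_ordKV.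
apply: eq_bigr => i _; rewrite hom_mx_simplex castmxE /=; congr (l _ _ *: _).
  by rewrite cast_ord_id.
by rewrite cast_ordK.
Qed.

Lemma simplex_row_full : row_full (hom_mx simplex_vertices).
Proof.
apply/row_fullP; exists (castmx (erefl d.+1,
  esym size_simplex_vertices) (invmx simplex_mx)).
apply/row_matrixP => i; rewrite row_mul mulmx_hom_simplex.
have -> : castmx (erefl 1%N, size_simplex_vertices) (row i (castmx (erefl d.+1,
  esym size_simplex_vertices) (invmx simplex_mx))) = row i (invmx simplex_mx).
  by apply/rowP => j; rewrite castmxE !mxE castmxE /= !cast_ord_id cast_ordK.
by rewrite -row_mul mulVmx // simplex_mx_unit.
Qed.

Lemma simplex_cone_lattice n : cone_lattice (hom_mx simplex_vertices) n =
  cone_slice simplex_mx (fun=> false) n.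
Proof.
apply/seteqP; split => z [hz zn].
  move=> [l [l0 zl]]; split => // i.
  by rewrite zl mulmx_hom_simplex mulmxK ?simplex_mx_unit // castmxE /= cast_ord_id.
move=> zi; split => //.
exists (castmx (erefl 1%N, esym size_simplex_vertices) (z *m invmx simplex_mx)); split.
  by move=> i; rewrite castmxE /= cast_ord_id.
rewrite mulmx_hom_simplex castmxKV mulmxKV ?simplex_mx_unit //.
Qed.

(** The closed cone over the simplex needs no subdivision and loses no facet; its box points have
    height 0 for [l = 0] and [p + 1] for the other [m - 1] values. *)
Lemma simplex_lattice_count n : (0 < n)%N ->
  lattice_count (conv_hull [set` simplex_vertices]) n =
  (\sum_(i <- d :: nseq m.-1 (d - p.+1)) 'C(n + i, d))%N.
Proof.
move=> n0; rewrite lattice_count_cone // simplex_cone_lattice card_cone_slice; last first.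
- by exists ord0.
- exact: simplex_mx_unit.
- exact: simplex_mx1.
- move=> i; rewrite rowK; apply: (@Zlattice_hom _ _ 1); apply: simplex_vertices_lattice.
  by apply: map_f; rewrite mem_enum.
pose hts := map (fun l : 'I_m => ((0 < l)%N * p.+1)%N) (enum 'I_m).
have binj : {in enum 'I_m &, injective (fun l : 'I_m => box_point l)}.
  move=> l l' _ _ /rowP e; have [t tm] := last_index.
  have := e (lift ord0 t); rewrite !box_point_coord tm eqxx => /eqP.
  by rewrite eqr_nat => /eqP; exact: val_inj.
have -> : (\sum_(j <- box_heights simplex_mx (fun=> false)) 'C(n + (d - j), d) =
    \sum_(j <- hts) 'C(n + (d - j), d))%N.
  apply: perm_big; rewrite /box_heights.
  apply: (@perm_trans _ [seq height_nat z | z <- map (fun l : 'I_m => box_point l) (enum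
    'I_m)]).
    apply: perm_map; apply: uniq_perm.
    - exact: fset_uniq.
    - by rewrite (map_inj_in_uniq binj) enum_uniq.
    move=> z; rewrite in_fset_set; last first.
      by apply: fund_box_finite; exact: simplex_mx_unit.
    apply/idP/idP; rewrite inE.
      by move=> /mem_fund_box[l ->]; apply: map_f; rewrite mem_enum.
    by move=> /mapP[l _ ->]; apply/mem_fund_box; exists l.
  rewrite -map_comp /hts (eq_map (g := fun l : 'I_m => ((0 < l)%N * p.+1)%N)) // => l /=.
  by rewrite /height_nat box_point_height natrK.
rewrite /hts big_map big_enum /= big_cons big_nseq.
case: (m) m0 => // m' _; rewrite big_ord_recl /= mul0n subn0; congr addn.
by rewrite mul1n sum_nat_const card_ord iter_addn_0 mulnC.
Qed.

End ExtremalSimplex.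

Theorem theorem1p5 (R : realType) (d r : nat)
    (hd : (6 <= d)%N) (hr3 : (3 <= r)%N) (hrd : (r <= d - 3)%N)
    (hpar : ~~ odd (d - r)) :
  (forall P : set 'rV[R]_d, integral_polytope P -> has_dim P d ->
     ehrhart_coef r P >=
       (d`!%:R)^-1 * ((stirl d.+1 r.+1)%:~R
                      + (d`!%:R * vol P - 1) * (M_min r d)%:~R))
  /\
  (forall m : nat, (0 < m)%N ->
     exists P : set 'rV[R]_d,
       [/\ integral_polytope P, has_dim P d, d`!%:R * vol P = m%:R &
           ehrhart_coef r P =
             (d`!%:R)^-1 * ((stirl d.+1 r.+1)%:~R
                            + (d`!%:R * vol P - 1) * (M_min r d)%:~R)]).
Proof.
have d0 : (0 < d)%N by lia.
have d3 : (3 <= d)%N by lia.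
have rd : (r < d)%N by lia.
rewrite (stirl_Ccoef (ltnW rd) hpar); split.
  move=> P /integral_polytope_generators[s -> sZ] /affine_hull_full/affine_hull_hom_mx rf.
  have [I Id hI] := ehrhart_series sZ rf.
  have [-> ->] := ehrhart_coef_vol r d0 sZ rf hI.
  (* The factor of [M_min] is [size I], so the bound is compared term by term. *)
  rewrite ler_wpM2l ?invr_ge0 // lerD2l mulrC -[_%:R]/((size I)%:Z%:~R) -intrM ler_int.
  rewrite -sum1_size -natz natr_sum mulr_sumr; rewrite big_seq [leRHS]big_seq.
  apply: ler_sum => i iI.
  by rewrite mulr1 M_min_le_all //; exact: (allP Id).
move=> m m0; have [p [pd pd1 Mp]] := M_min_attained_half d3 rd hpar.
pose s := @simplex_vertices R d p m.
have sZ := @simplex_vertices_lattice R d p m.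
have rf := @simplex_row_full R d p m pd m0.
have [cE vE] := ehrhart_coef_vol r d0 sZ rf (@simplex_lattice_count R d p m pd m0).
exists (conv_hull [set` s]); split.
- split; first by exists s.
  by move=> v /vertex_conv_hull; exact: sZ.
- by apply: has_dim_full; apply/affine_hull_hom_mx.
- by rewrite -[LHS](subrK 1) vE size_nseq natr1 prednK.
rewrite cE vE; congr (_ * (_ + _)).
(* All [m - 1] entries equal [d - p.+1], where the minimum is attained. *)
by rewrite big_nseq iter_addr_0 size_nseq Mp rmorphMn /= mulr_natl.
Qed.
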